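(* Let $f:\mathbb{A}\to\mathbb{A}$ be a negative-torsion map of the annulus $\mathbb{A}=\mathbb{T}\times\mathbb{R}$. Then for any $\mathcal{C}^1$ essential curve $\gamma:\mathbb{T}\to\mathbb{A}$ there exists a point $z\in\gamma(\mathbb{T})$ such that the torsion of $f$ at $z$ exists and $\mathrm{Torsion}(f,z)=0$.
   Context: $\mathbb{T}=\mathbb{R}/\mathbb{Z}$, $\mathbb{A}=\mathbb{T}\times\mathbb{R}$ with the standard Riemannian metric and the standard trivialization of its tangent bundle ($T_x\mathbb{A}\cong\mathbb{R}^2$), with the counterclockwise orientation. $\chi=(0,1)$ is the unit positive vertical vector. For non-zero vectors $u,v\in\mathbb{R}^2$, $\theta(u,v)\in\mathbb{T}$ is the oriented angle from $u$ to $v$, measured in turns (a full counterclockwise turn is $1$). An isotopy is an arc in $\mathrm{Diff}^1(\mathbb{A})$ continuous for the compact-open (weak) $\mathcal{C}^1$ topology. Let $f:\mathbb{A}\to\mathbb{A}$ be a $\mathcal{C}^1$ diffeomorphism isotopic to the identity, and $(f_t)_{t\in[0,1]}$ an isotopy with $f_0=\mathrm{Id}$, $f_1=f$; extend it to $t\in\mathbb{R}_+=[0,+\infty)$ by $f_t=f_{t-\lfloor t\rfloor}\circ f^{\lfloor t\rfloor}$, and write $I=(f_t)_{t\ge0}$. For $x\in\mathbb{A}$ and $\xi\in T_x\mathbb{A}\setminus\{0\}$ let $\tilde v(I,x,\xi):\mathbb{R}_+\to\mathbb{R}$ be a continuous lift of $t\mapsto\theta(\chi,Df_t(x)\xi)\in\mathbb{T}$.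 For an integer $n\ge1$, $$\mathrm{Torsion}_n(f,x,\xi)=\frac{\tilde v(I,x,\xi)(n)-\tilde v(I,x,\xi)(0)}{n}.$$ This does not depend on the lift nor on the chosen isotopy. The torsion at $x$ is $\mathrm{Torsion}(f,x)=\lim_{n\to+\infty}\mathrm{Torsion}_n(f,x,\xi)$ whenever the limit exists; it does not depend on $\xi\neq0$. A negative-torsion map is a $\mathcal{C}^1$ diffeomorphism $f:\mathbb{A}\to\mathbb{A}$ isotopic to the identity such that $\mathrm{Torsion}_1(f,z,\chi)<0$ for every $z\in\mathbb{A}$. An essential curve is a $\mathcal{C}^0$ embedded circle $\gamma:\mathbb{T}\to\mathbb{A}$ not homotopic to a point; it is a $\mathcal{C}^1$ essential curve if $\gamma$ is moreover a $\mathcal{C}^1$ embedding (so $\gamma'(s)\neq0$ for all $s$). *)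

(* Defs.v *)
From HB Require Import structures.
From mathcomp Require Import all_boot all_order all_algebra generic_quotient.
From mathcomp Require Import all_classical all_reals all_analysis.

Set Implicit Arguments.
Unset Strict Implicit.
Unset Printing Implicit Defensive.

Import Order.TTheory GRing.Theory Num.Theory.
Import numFieldNormedType.Exports.

Local Open Scope classical_set_scope.
Local Open Scope ring_scope.
Local Open Scope quotient_scope.

Section Circle.
Context {R : realType}.

Definition eqmodZ (x y : R) : bool := (x - y) \is a Num.int.

Lemma eqmodZ_equiv : equiv_class_of eqmodZ.
Proof.
split=> [x|x y|y x z]; rewrite /eqmodZ.
- by rewrite subrr rpred0.
- by rewrite -opprB rpredN.
- by move=> xy yz; rewrite -(subrKA y) rpredD.
Qed.

Canonical eqmodZ_equiv_rel := EquivRelPack eqmodZ_equiv.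

End Circle.

Definition circle (R : realType) : ptopologicalType :=
  quotient_topology {eq_quot (@eqmodZ R)}.

Definition annulus (R : realType) : Type := (circle R * R)%type.

Section Coverings.
Context {R : realType}.

Definition circle_cover (x : R) : circle R := 
  \pi_(quotient_topology {eq_quot (@eqmodZ R)}) x.

Definition annulus_cover (z : R * R) : annulus R := (circle_cover z.1, z.2).

End Coverings.

(* For M = R/Z or A, local inverses of the covering map of M are the charts of
   M, and their transition maps are translations, so they induce the standard
   trivialization of the tangent bundle. The predicate below says that [f],
   read in charts around [x] and [f x], is differentiable with differential
   [L]; [L] does not depend on the charts. *)
Section Differential.
Context {R : realType} {U V : normedModType R} {M N : topologicalType}.
Variables (p : U -> M) (q : V -> N).

Definition has_differential (f : M -> N) (x : M) (L : U -> V) : Prop :=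
  exists (z : U) (F : U -> V),
    [/\ p z = x, \forall w \near z, q (F w) = f (p w),
        differentiable F z & L = 'd F z].

Definition differential (f : M -> N) (x : M) : U -> V :=
  get (has_differential f x).

Definition C1 (f : M -> N) : Prop :=
  (forall x, exists L, has_differential f x L) /\
  (forall u, continuous (fun x => differential f x u)).

End Differential.

Section Annulus.
Context {R : realType}.
Local Notation A := (annulus R).
Local Notation vec := (R * R)%type.

Definition D : (A -> A) -> A -> vec -> vec :=
  differential annulus_cover annulus_cover.

Definition diffeo1 (f : A -> A) : Prop :=
  C1 annulus_cover annulus_cover f /\
  exists g, [/\ cancel f g, cancel g f & C1 annulus_cover annulus_cover g].

(* Only the restriction of [I] to [0, 1] is constrained. The last two
   conditions are continuity for the weak C^1 topology, i.e. the initial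
   topology of f |-> (f, Df) for the compact-open topologies; as the tangent
   space has finite dimension, Df is tested on each constant vector. *)
Definition isotopy (I : R -> A -> A) : Prop :=
  [/\ forall t, t \in `[0, 1] -> diffeo1 (I t),
      {within `[0, 1], continuous (I : R -> {compact-open, A -> A})} &
      forall u : vec, {within `[0, 1], continuous
        ((fun t x => D (I t) x u) : R -> {compact-open, A -> vec})}].

Definition isotopy_from_id (f : A -> A) (I : R -> A -> A) : Prop :=
  [/\ isotopy I, I 0 = id & I 1 = f].

Definition isotopic_to_id (f : A -> A) : Prop :=
  exists I, isotopy_from_id f I.

Definition extend_isotopy (I : R -> A -> A) (t : R) : A -> A :=
  I (t - (Num.truncn t)%:R) \o iter (Num.truncn t) (I 1).

Definition chi : vec := (0, 1).

Definition dot (u v : vec) : R := u.1 * v.1 + u.2 * v.2.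

Definition cross (u v : vec) : R := u.1 * v.2 - u.2 * v.1.

(* The oriented angle in turns: the counterclockwise angle from [u] to [v] lies
   in [0, 1/2] when [cross u v >= 0], and in [-1/2, 0] otherwise. *)
Definition theta (u v : vec) : circle R :=
  let a := acos (dot u v / (Num.sqrt (dot u u) * Num.sqrt (dot v v)))
           / (2 * pi) in
  circle_cover (if 0 <= cross u v then a else - a).

Definition angle_lift (I : R -> A -> A) (x : A) (xi : vec) (v : R -> R) :
    Prop :=
  {within `[0, +oo[, continuous v} /\
  forall t, 0 <= t ->
    circle_cover (v t) = theta chi (D (extend_isotopy I t) x xi).

(* The finite-time torsion does not depend on the isotopy nor on the lift, so
   both are chosen; the choice of the isotopy depends on [f] only. *)
Definition chosen_isotopy (f : A -> A) : R -> A -> A :=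
  get (isotopy_from_id f).

Definition vtilde (I : R -> A -> A) (x : A) (xi : vec) : R -> R :=
  get (angle_lift I x xi).

Definition torsion_n (n : nat) (f : A -> A) (x : A) (xi : vec) : R :=
  let v := vtilde (chosen_isotopy f) x xi in (v n%:R - v 0) / n%:R.

Definition has_torsion (f : A -> A) (x : A) (l : R) : Prop :=
  forall xi : vec, xi != 0 -> torsion_n n f x xi @[n --> \oo] --> l.

Definition negative_torsion_map (f : A -> A) : Prop :=
  [/\ diffeo1 f, isotopic_to_id f & forall z, torsion_n 1 f z chi < 0].

Definition topological_embedding (M N : topologicalType) (g : M -> N) : Prop :=
  [/\ injective g, continuous g &
      forall U, open U -> exists2 V, open V & U = g @^-1` V].

Definition null_homotopic (gamma : circle R -> A) : Prop :=
  exists H : circle R * R -> A,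
    [/\ {within [set sr | 0 <= sr.2 <= 1], continuous H},
        forall s, H (s, 0) = gamma s &
        exists c, forall s, H (s, 1) = c].

Definition essential_curve (gamma : circle R -> A) : Prop :=
  topological_embedding gamma /\ ~ null_homotopic gamma.

Definition velocity (gamma : circle R -> A) (s : circle R) : vec :=
  differential circle_cover annulus_cover gamma s 1.

Definition C1_essential_curve (gamma : circle R -> A) : Prop :=
  [/\ essential_curve gamma, C1 circle_cover annulus_cover gamma &
      forall s, velocity gamma s != 0].

End Annulus.

(* Main.v *)
(* The vertical vector turns clockwise under f and distinct lines never cross
   under an isotopy, so an angle, measured from the vertical, which is at most
   k/2 remains so at all later times: rotations are bounded above, and an upper
   bound on an angle at time m persists up to time n >= m.
   For the lower bound, argue as in Hopf's Umlaufsatz. Let c_t be a lift to R^2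
   of f_t o gamma. The chords c_t(s + h) - c_t(s), 0 < h <= 1, together with the
   tangents at h = 0, form a continuous non-vanishing family, so they have a
   continuous angle; for h = 1 the chord is a fixed horizontal vector (d, 0),
   with d <> 0 because gamma is essential, and its angle does not depend on t
   and s. At a highest point of c_n no chord points upwards, so going from
   h = 1 to h = 0 the angle changes by less than one turn. Hence for every n
   some tangent vector to gamma has an angle at time n bounded below
   independently of n, and, by the first remark, so it has at all earlier
   times. A limit point of such points of gamma has bounded rotation, hence zero
   torsion. *)
Require Import Defs.
From mathcomp Require Import all_boot all_order all_algebra generic_quotient.
From mathcomp Require Import all_classical all_reals all_analysis.
From mathcomp Require Import ring lra zify.

Set Implicit Arguments.
Unset Strict Implicit.
Unset Printing Implicit Defensive.

Import Order.TTheory GRing.Theory Num.Theory.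
Import numFieldNormedType.Exports.

Local Open Scope classical_set_scope.
Local Open Scope ring_scope.

(** * Angles in turns *)

Section Angle.
Context {R : realType}.
Implicit Types (a b : R) (u v w : R * R).

Lemma circle_coverP (x y : R) :
  circle_cover x = circle_cover y <-> x - y \is a Num.int.
Proof. by split=> [/eqquotP|?]; [|apply/eqquotP]. Qed.

(* The unit vector at angle [a], in turns, from [chi]. *)
Definition turn a : R * R := (- sin (a * (pi *+ 2)), cos (a * (pi *+ 2))).

(** A relation, so that real-valued angles can be compared without passing to the circle; [theta]
    enters only through [theta_chiP]. *)
Definition has_angle a w : Prop := exists2 r, 0 < r & w = r *: turn a.

Lemma turnD_int a (m : int) : turn (a + m%:~R) = turn a.
Proof.
have natE (n : nat) b : turn (b + n%:R) = turn b.
  rewrite /turn mulrDl [n%:R * _]mulr_natl.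
  by rewrite (periodicn (@sinD2pi R)) (periodicn (@cosD2pi R)).
case: m => n; first by rewrite natE.
by rewrite NegzE -[in RHS](subrK n.+1%:R a) natE mulrNz.
Qed.

Lemma turn_norm a : (turn a).1 ^+ 2 + (turn a).2 ^+ 2 = 1.
Proof. by rewrite /= sqrrN addrC cos2Dsin2. Qed.

Lemma turn_inj_int a b : turn a = turn b -> a - b \is a Num.int.
Proof.
have pi2 : 0 < pi *+ 2 :> R by rewrite mulrn_wgt0// pi_gt0.
move=> [] /oppr_inj es ec.
set x := a - b; set n := Num.floor x; set y := x - n%:~R.
have y01 : 0 <= y < 1.
  by rewrite subr_ge0 ltrBlDl floor_le//= -[1]/(1%:~R) -intrD floorD1_gt.
have [sy cy] : sin (y * (pi *+ 2)) = 0 /\ cos (y * (pi *+ 2)) = 1.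
  have := turnD_int x (- n); rewrite mulrNz -/y => -[/oppr_inj -> ->].
  rewrite /x mulrBl sinB cosB es ec; split; first by ring.
  by rewrite -!expr2 cos2Dsin2.
suff y0 : y = 0 by move/eqP: y0; rewrite subr_eq0 => /eqP ->; exact: intr_int.
apply/eqP/negPn/negP => yn0.
have y0 : 0 < y by lra.
have p0 : 0 < pi :> R := pi_gt0 R.
(* Strictly between 0 and 1 the sine vanishes only at the half turn, where the cosine is -1. *)
have [yh|yh|yh] := ltgtP y (1 / 2).
- have : 0 < sin (y * (pi *+ 2)).
    apply: sin_gt0_pi; apply/andP; split; first by rewrite mulr_gt0.
    by rewrite -mulr_natr; nra.
  by rewrite sy ltxx.
- have : 0 < sin (y * (pi *+ 2) - pi).
    by apply: sin_gt0_pi; rewrite -mulr_natr; apply/andP; split; nra.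
  by rewrite sinB sy sinpi !mul0r mulr0 subr0 ltxx.
- move: cy; rewrite yh (_ : _ * _ = pi) ?cospi; last by rewrite -mulr_natr; field.
  by move=> /eqP; rewrite lt_eqF// ltrN10.
Qed.

Lemma turn_neq0 a : turn a <> 0.
Proof.
move=> h; have := turn_norm a; rewrite h /= expr0n /= addr0 => /eqP.
by rewrite eq_sym oner_eq0.
Qed.

Lemma scale_turn_eq (r s : R) a b :
  0 < r -> 0 < s -> r *: turn a = s *: turn b -> r = s.
Proof.
move=> r0 s0 [] e1 e2.
have sq : r ^+ 2 = s ^+ 2.
  rewrite -[LHS]mulr1 -[RHS]mulr1 -{1}(turn_norm a) -(turn_norm b).
  by rewrite !mulrDr -!exprMn; move: e1 e2; rewrite /GRing.scale /= => -> ->.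
by apply/eqP; rewrite -(@eqrXn2 _ 2)// ?sq// ltW.
Qed.

Lemma has_angle_eq a b w : has_angle a w -> has_angle b w ->
  a - b \is a Num.int.
Proof.
move=> [r r0 ->] [s s0 e]; apply: turn_inj_int.
have rs := scale_turn_eq r0 s0 e; subst s.
by apply: (@scalerI _ _ r) => //; rewrite gt_eqF.
Qed.

Lemma has_angle_shift a b w : a - b \is a Num.int -> has_angle a w ->
  has_angle b w.
Proof.
move=> /intrP[m am] [r r0 ->]; exists r => //; congr (_ *: _).
by rewrite -(turnD_int b m) -am addrC subrK.
Qed.

Lemma sqnorm_gt0 w : w != 0 -> 0 < w.1 ^+ 2 + w.2 ^+ 2.
Proof.
move=> w0; rewrite lt_neqAle addr_ge0 ?sqr_ge0// andbT eq_sym.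
rewrite paddr_eq0 ?sqr_ge0// !sqrf_eq0.
by apply: contra w0 => /andP[/eqP h1 /eqP h2]; rewrite [w]surjective_pairing h1 h2.
Qed.

(** The angle is written in the form to which [theta chi w] reduces, since [cross chi w = - w.1] and
    [dot chi w = w.2]. *)
Lemma has_angle_polar w : w != 0 -> has_angle
  (let c := acos (w.2 / Num.sqrt (w.1 ^+ 2 + w.2 ^+ 2)) / (2 * pi) in
   if 0 <= - w.1 then c else - c) w.
Proof.
move=> w0; set r := Num.sqrt _.
have s0 : 0 < w.1 ^+ 2 + w.2 ^+ 2 by exact: sqnorm_gt0.
have r0 : 0 < r by rewrite sqrtr_gt0.
have r2 : r ^+ 2 = w.1 ^+ 2 + w.2 ^+ 2 by rewrite sqr_sqrtr// ltW.
have q1 : (w.1 / r) ^+ 2 + (w.2 / r) ^+ 2 = 1.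
  by rewrite !expr_div_n -mulrDl -r2 divff// expf_neq0// gt_eqF.
have q : -1 <= w.2 / r <= 1.
  by rewrite -ler_norml -(@expr_le1 _ 2)// real_normK ?num_real// -q1 lerDr sqr_ge0.
set c := acos _ / _.
have cE : c * (pi *+ 2) = acos (w.2 / r).
  rewrite /c -[pi *+ 2]mulr_natl mulfVK// mulf_neq0// gt_eqF// pi_gt0//.
have sE : sin (acos (w.2 / r)) = `|w.1 / r|.
  by rewrite sin_acos// -q1 addrK sqrtr_sqr.
exists r => //; rewrite [LHS]surjective_pairing /turn /=.
have rn : r != 0 by rewrite gt_eqF.
case: ifP => w1; rewrite ?mulNr ?sinN ?cosN cE acosK// sE normrM [`|r^-1|]gtr0_norm ?invr_gt0//.
  rewrite ler0_norm; last by rewrite -oppr_ge0.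
  by congr (_, _); rewrite /GRing.scale /=; field.
rewrite gtr0_norm; last by rewrite ltNge -oppr_ge0 w1.
by congr (_, _); rewrite /GRing.scale /=; field.
Qed.

Lemma theta_chiP a w : w != 0 ->
  circle_cover a = theta chi w <-> has_angle a w.
Proof.
move=> w0; rewrite /theta /dot /cross /chi /=.
rewrite !mul0r !mul1r !add0r sqrtr1 mul1r -!expr2.
have := has_angle_polar w0 => /=; set b := if _ then _ else _ => hb.
split=> [/circle_coverP ab|ha]; last first.
  by apply/circle_coverP; exact: has_angle_eq ha hb.
apply: has_angle_shift hb; rewrite -opprB rpredN//.
Qed.

(** The signed angle from [u] to [v], in turns, when [dot u v > 0]: it is then less than a quarter
    turn, and an arctangent gives it continuously. *)
Definition small_angle u v : R := atan (cross u v / dot u v) / (pi *+ 2).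

Lemma has_angle_step a u v : 0 < dot u v -> has_angle a u ->
  has_angle (a + small_angle u v) v.
Proof.
move=> d0 [r r0 ue].
have p0 : pi *+ 2 != 0 :> R by rewrite gt_eqF// mulrn_wgt0// pi_gt0.
rewrite /small_angle; set q := cross u v / dot u v; set f := atan q.
have cf : 0 < cos f.
  by apply: cos_gt0_pihalf; rewrite atan_gtNpi2 atan_ltpi2.
have sf : sin f = q * cos f.
  by rewrite -[q]atanK -/f /tan divfK// gt_eqF.
exists (dot u v / (r * cos f)); first by rewrite divr_gt0// mulr_gt0.
rewrite /turn [(a + _) * _]mulrDl divfK// sinD cosD sf /q.
set s := sin _; set c := cos (a * _).
have sc : c ^+ 2 + s ^+ 2 = 1 by exact: cos2Dsin2.
have [u1 u2] : u.1 = - r * s /\ u.2 = r * c.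
  by rewrite ue /turn /= /GRing.scale /= mulNr mulrN.
have dn : dot u v != 0 by rewrite gt_eqF.
have rn : r != 0 by rewrite gt_eqF.
have cn : cos f != 0 by rewrite gt_eqF.
rewrite [LHS]surjective_pairing /=; congr (_, _).
  (* Multiplying by [c ^+ 2 + s ^+ 2 = 1] turns each coordinate into a rational identity. *)
  rewrite -[LHS]mulr1 -sc; apply/eqP; rewrite -subr_eq0; apply/eqP.
  transitivity (v.1 * (c ^+ 2 + s ^+ 2) - r^-1 * (- (s * dot u v + c * cross u v))); last first.
    rewrite /dot /cross u1 u2; by field.
  by congr (_ - _); rewrite /GRing.scale/=; field; rewrite dn cn rn.
rewrite -[LHS]mulr1 -sc; apply/eqP; rewrite -subr_eq0; apply/eqP.
transitivity (v.2 * (c ^+ 2 + s ^+ 2) - r^-1 * (c * dot u v - s * cross u v)); last first.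
  rewrite /dot /cross u1 u2; by field.
by congr (_ - _); rewrite /GRing.scale/=; field; rewrite dn cn rn.
Qed.

End Angle.

(** * Continuous lifts of angles *)

Section Lift.
Context {R : realType}.

Lemma continuous_pair (T U V : topologicalType) (f : T -> U) (g : T -> V) x :
  {for x, continuous f} -> {for x, continuous g} ->
  {for x, continuous (fun y => (f y, g y))}.
Proof. by move=> cf cg; apply: cvg_pair. Qed.

Lemma continuous_fst (U V : topologicalType) : continuous (@fst U V).
Proof. by move=> x; exact: cvg_fst. Qed.

Lemma continuous_snd (U V : topologicalType) : continuous (@snd U V).
Proof. by move=> x; exact: cvg_snd. Qed.

Lemma continuous_comp1 (T U V : topologicalType) (f : T -> U * V) x :
  {for x, continuous f} -> {for x, continuous (fun y => (f y).1)}.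
Proof. by move=> cf; apply: (continuous_comp cf); exact: continuous_fst. Qed.

Lemma continuous_comp2 (T U V : topologicalType) (f : T -> U * V) x :
  {for x, continuous f} -> {for x, continuous (fun y => (f y).2)}.
Proof. by move=> cf; apply: (continuous_comp cf); exact: continuous_snd. Qed.

(** Retraction of the line onto a segment. It replaces functions on a segment by continuous
    functions on the whole line, away from subspace topologies. *)
Definition clamp (a b x : R) : R := Num.max a (Num.min b x).

Lemma continuous_clamp a b : continuous (clamp a b).
Proof.
move=> x; apply: (@continuous_max _ _ (fun=> a) (fun x => Num.min b x)).
  exact: cvg_cst.
by apply: (@continuous_min _ _ (fun=> b) id); [exact: cvg_cst|exact: cvg_id].
Qed.

Lemma clamp_itv a b x : a <= b -> a <= clamp a b x <= b.
Proof. by move=> ab; rewrite le_max lexx ge_max ab ge_min lexx. Qed.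

Lemma clamp_id a b x : a <= x <= b -> clamp a b x = x.
Proof. by move=> /andP[ax xb]; rewrite /clamp min_r// max_r. Qed.

Lemma clampK a b x : a <= b -> clamp a b (clamp a b x) = clamp a b x.
Proof. by move=> ab; rewrite clamp_id// clamp_itv. Qed.

(** If the end values differed, the smaller one plus one half would be attained, by the intermediate
    value theorem. *)
Lemma int_valued_const (f : R -> R) (a b : R) : a <= b ->
  {within `[a, b], continuous f} ->
  (forall t, a <= t <= b -> f t \is a Num.int) -> f a = f b.
Proof.
move=> ab cf fint.
have half (m : R) : m \is a Num.int -> m + 2^-1 \isn't a Num.int.
  move=> mi; apply/negP => h; have : m + 2^-1 - m \is a Num.int by rewrite rpredB.
  rewrite addrAC subrr add0r => /intrP[n hn].
  have : (n * 2)%:~R = 1%:~R :> R by rewrite intrM -hn mulVf.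
  by move=> /intr_inj; lia.
have a_in : f a \is a Num.int by apply: fint; rewrite lexx ab.
have b_in : f b \is a Num.int by apply: fint; rewrite lexx ab.
have gap (x y : R) : x \is a Num.int -> y \is a Num.int -> x < y -> x + 2^-1 <= y.
  move=> /intrP[m ->] /intrP[n ->]; rewrite ltr_int -lezD1 => mn.
  have : (m + 1)%:~R <= n%:~R :> R by rewrite ler_int.
  rewrite intrD; lra.
apply/eqP/negPn/negP; rewrite neq_lt => /orP[] lt.
- have [|c cab fc] := @IVT _ f a b (f a + 2^-1) ab cf.
    by have := gap _ _ a_in b_in lt; rewrite (min_l (ltW lt)) (max_r (ltW lt)); lra.
  by have := half _ a_in; rewrite -fc fint// -in_itv.
- have [|c cab fc] := @IVT _ f a b (f b + 2^-1) ab cf.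
    by have := gap _ _ b_in a_in lt; rewrite (min_r (ltW lt)) (max_l (ltW lt)); lra.
  by have := half _ b_in; rewrite -fc fint// -in_itv.
Qed.

(** Two angles of the same vector differ by an integer, which is constant by continuity. *)
Lemma angle_variation_uniq (u v : R -> R) (w : R -> R * R) (a b : R) : a <= b ->
  {within `[a, b], continuous u} -> {within `[a, b], continuous v} ->
  (forall t, a <= t <= b -> has_angle (u t) (w t)) ->
  (forall t, a <= t <= b -> has_angle (v t) (w t)) ->
  u b - u a = v b - v a.
Proof.
move=> ab cu cv hu hv.
have h : u a - v a = u b - v b.
  apply: (@int_valued_const (fun t => u t - v t)) => //.
    by move=> x; apply: cvgB; [exact: cu|exact: cv].
  by move=> t tab; apply: (has_angle_eq (hu _ tab) (hv _ tab)).
lra.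
Qed.

Lemma continuous_dot (T : topologicalType) (f g : T -> R * R) x :
  {for x, continuous f} -> {for x, continuous g} ->
  {for x, continuous (fun y => dot (f y) (g y))}.
Proof.
by move=> cf cg; apply: cvgD; apply: cvgM;
  (exact: continuous_comp1 || exact: continuous_comp2).
Qed.

Lemma continuous_small_angle (T : topologicalType) (f g : T -> R * R) x :
  0 < dot (f x) (g x) ->
  {for x, continuous f} -> {for x, continuous g} ->
  {for x, continuous (fun y => small_angle (f y) (g y))}.
Proof.
move=> fg cf cg; apply: cvgMl.
apply: (cvg_comp _ atan); last exact: continuous_atan.
apply: cvgM; last first.
  by apply: cvgV; [rewrite gt_eqF|exact: continuous_dot].
by apply: cvgB; apply: cvgM;
  (exact: continuous_comp1 || exact: continuous_comp2).
Qed.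

(** Radial lifting: cut the segment from 0 to [c p] into [N] equal pieces, with [N] independent of
    [p], so that consecutive values of [w] make an acute angle. A fixed angle of [w 0] plus the sum
    of these small angles depends continuously on [p]. *)
Lemma exists_angle (V : normedModType R) (K : set V) (c : V -> V)
    (w : V -> R * R) :
  compact K -> (forall p (t : R), K p -> 0 <= t <= 1 -> K (t *: p)) ->
  continuous c -> (forall p, K (c p)) -> (forall p, w (c p) = w p) ->
  continuous w -> (forall p, w p != 0) ->
  exists2 a : V -> R, continuous a & forall p, has_angle (a p) (w p).
Proof.
move=> Kc Kstar cc Kcp wc cw w0.
have dotpp p : 0 < dot (w p) (w p).
  by rewrite /dot -!expr2 sqnorm_gt0.
(* Uniform continuity on the compact [K], in the form needed: points closer than [d] have values at
   an acute angle. *)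
have [d d0 Hd] : exists2 d : R, 0 < d & forall p q, K p -> `|p - q| < d ->
    0 < dot (w p) (w q).
  have /compact_near_coveringP/(_ R (nbhs (0 : R)^'+)
    (fun d p => forall q, `|p - q| < d -> 0 < dot (w p) (w q))) := Kc.
  have covers p : K p -> \forall p' \near p & d \near (0 : R)^'+,
      forall q, `|p' - q| < d -> 0 < dot (w p') (w q).
    move=> _.
    have : \forall z \near (p, p), 0 < dot (w z.1) (w z.2).
      have : {for (p, p), continuous (fun z : V * V => dot (w z.1) (w z.2))}.
        by apply: continuous_dot; apply: continuous_comp => //;
          [exact: continuous_fst|exact: cw|exact: continuous_snd|exact: cw].
      by move/(_ [set x | 0 < x]); apply; apply: lt_nbhsr; exact: dotpp.
    move=> /nbhs_ballP[e /= e0 He].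
    exists (ball p (e / 2), [set d | 0 < d < e / 2]).
      split; first exact/nbhsx_ballx/divr_gt0.
      by near=> d => /=; apply/andP; split; near: d;
        [exact: nbhs_right_gt|apply: nbhs_right_lt; exact: divr_gt0].
    move=> [p' d] /= [pp' /andP[d0 de]] q p'q.
    apply: (He (p', q)); split => /=; first by apply: le_ball pp'; lra.
    rewrite [e]splitr; apply: ball_triangle pp' _.
    by rewrite -ball_normE /=; apply: lt_trans de.
  move=> /(_ _ covers) /= H.
  have [d [d0 dH]] : exists d : R, 0 < d /\ forall p, K p ->
      forall q, `|p - q| < d -> 0 < dot (w p) (w q).
    near (0 : R)^'+ => d; exists d; split; first by near: d; exact: nbhs_right_gt.
    by near: d.
  by exists d => // p q Kp; apply: dH.
have [M [Mr KM]] := compact_bounded Kc.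
pose B := Num.max M 0 + 1.
have B0 : 0 < B by rewrite ltr_wpDl// le_max lexx orbT.
have KB p : K p -> `|p| <= B.
  by move=> Kp; apply: KM Kp; rewrite (le_lt_trans (y := Num.max M 0))// ?le_max ?lexx// ltrDl.
(* As [B] bounds the norm on [K], the pieces have length at most [B / N < d]. *)
pose N := (Num.truncn (B / d)).+1.
have NB : B / d < N%:R by exact: truncnS_gt.
have N0 : 0 < N%:R :> R by rewrite ltr0n.
have step k : (k <= N)%N -> exists2 a : V -> R, continuous a &
    forall p, has_angle (a p) (w ((k%:R / N%:R) *: c p)).
  elim: k => [_|k IH kN].
    have [a0 ha0] : exists a, has_angle a (w 0) by eexists; exact: has_angle_polar.
    exists (fun=> a0); first by move=> x; exact: cvg_cst.
    by move=> p; rewrite mul0r scale0r.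
  have [a ca ha] := IH (ltnW kN).
  pose u j p := w ((j%:R / N%:R) *: c p).
  have cu j : continuous (u j).
    move=> p; apply: (@continuous_comp _ _ _ (fun p => (j%:R / N%:R) *: c p) w);
      last exact: cw.
    by apply: cvgZr; exact: cc.
  have upos p : 0 < dot (u k p) (u k.+1 p).
    apply: Hd.
      apply: Kstar => //; rewrite divr_ge0 ?ler0n//= ler_pdivrMr// mul1r ler_nat.
      exact: ltnW.
    rewrite distrC -scalerBl -mulrBl -natrB// subSnn mul1r normrZ.
    rewrite gtr0_norm ?invr_gt0// mulrC ltr_pdivrMr// mulrC.
    by rewrite -ltr_pdivrMr//; apply: le_lt_trans NB; rewrite ler_pM2r ?invr_gt0// KB.
  exists (fun p => a p + small_angle (u k p) (u k.+1 p)).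
    by move=> p; apply: cvgD;
      [exact: ca|apply: continuous_small_angle => //; exact: cu].
  by move=> p; apply: has_angle_step => //; exact: ha.
have [a ca ha] := step N (leqnn _).
exists a => // p; have := ha p; rewrite divff ?gt_eqF// scale1r wc//.
Unshelve. all: end_near.
Qed.

End Lift.

(** * Differentials through coverings *)

Section NearDiff.
Context {R : realType} {U V : normedModType R}.

Lemma near_eq_is_diff (f g L : U -> V) (z : U) :
  (\forall w \near z, f w = g w) -> is_diff z g L -> is_diff z f L.
Proof.
move=> fg [dg <-].
have [cd eg] := (diff_locallyP _ _).1 dg.
have ef : f \o shift z = cst (f z) + 'd g z +o_ 0 id.
  apply/eqaddoP => e e0; have /eqaddoP/(_ e e0) H := eg.
  have fg0 : \forall h \near (0 : U), f (h + z) = g (h + z).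
    by move: fg; rewrite (near_shift 0); apply: filterS => h /=; rewrite subr0.
  apply: filterS2 fg0 H => h /= eh; rewrite !fctE /=.
  by rewrite eh (nbhs_singleton fg).
have e := diff_unique cd ef.
have df : differentiable f z by apply/diff_locallyP; rewrite e.
exact: DiffDef df e.
Qed.

End NearDiff.

(* What is used of the universal coverings of the circle and of the annulus:
   the deck transformations are translations by a discrete group. *)
Record covering (R : realType) (U : normedModType R) (M : topologicalType)
    (p : U -> M) : Prop := Covering {
  covering_continuous : continuous p;
  covering_open : forall A, open A -> open (p @` A);
  covering_surj : forall x, exists z, p z = x;
  covering_transl : forall z z' w, p z = p z' -> p (w + (z' - z)) = p w;
  covering_discrete : exists2 e : R, 0 < e &
    forall y y', p y = p y' -> `|y - y'| < e -> y = y' }.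

Section Covering.
Context {R : realType} {U V : normedModType R} {M N : topologicalType}.
Context {p : U -> M} {q : V -> N}.
Hypotheses (cp : covering p) (cq : covering q).

Lemma nbhs_covering z (A : set M) : nbhs z (p @^-1` A) -> nbhs (p z) A.
Proof.
move=> nzA; have [B [oB Bz] BA] : exists2 B, open_nbhs z B & B `<=` p @^-1` A.
  by move: nzA; rewrite nbhsE.
apply: (@filterS _ _ _ (p @` B)).
  by move=> _ [w Bw <-]; exact: BA.
by apply: open_nbhs_nbhs; split; [exact: covering_open|exists z].
Qed.

Lemma covering_cvg z (T : topologicalType) (f : M -> T) :
  {for z, continuous (f \o p)} -> {for p z, continuous f}.
Proof. by move=> cf A /cf; apply: nbhs_covering. Qed.

(** The two sides agree at [z] and have the same projection nearby, where by continuity they are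
    closer than the discreteness constant of the covering. *)
Lemma lift_uniq_near (T : topologicalType) (F G : T -> V) (z : T) :
  {for z, continuous F} -> {for z, continuous G} ->
  (\forall w \near z, q (F w) = q (G w)) ->
  \forall w \near z, F w = G w + (F z - G z).
Proof.
move=> cF cG FG; have [e e0 He] := covering_discrete cq.
have cd : {for z, continuous (fun w => F w - (G w + (F z - G z)))}.
  by apply: cvgB => //; apply: cvgD => //; exact: cvg_cst.
have : \forall w \near z, `|F w - (G w + (F z - G z))| < e.
  have : {for z, continuous (fun w => `|F w - (G w + (F z - G z))|)}.
    exact: cvg_norm.
  move/(_ [set x | x < e]); apply; apply: lt_nbhsl.
  by rewrite [G z + _]addrC subrK subrr normr0.
have FGz := nbhs_singleton FG.
move=> H; apply: filterS2 FG H => w FGw; apply: He.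
by rewrite FGw [RHS](covering_transl cq)// -FGz.
Qed.

Lemma is_diff_shift (z c : U) : is_diff z (fun w : U => w + c) id.
Proof.
have := is_diffD (is_diff_id z) (is_diff_cst c z).
by rewrite addr0.
Qed.

Lemma is_diff_lift (F G L : U -> V) (z : U) : {for z, continuous F} ->
  (\forall w \near z, q (F w) = q (G w)) -> is_diff z G L -> is_diff z F L.
Proof.
move=> cF FG dG.
have cG : {for z, continuous G} by apply: differentiable_continuous.
apply: near_eq_is_diff (lift_uniq_near cF cG FG) _.
have := is_diffD dG (is_diff_cst (F z - G z) z).
by rewrite addr0.
Qed.

(** The lift given by [has_differential] sits over some preimage of the point; deck translations in
    the source and in the target move it to the prescribed preimages [z] and [y]. *)
Lemma has_differential_at (f : M -> N) (z : U) (y : V) (L : U -> V) :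
  has_differential p q f (p z) L -> q y = f (p z) ->
  exists F : U -> V, [/\ F z = y, \forall w \near z, q (F w) = f (p w) &
    is_diff z F L].
Proof.
move=> [z0 [F0 [z0z Ff dF ->]]] qy.
pose F w := F0 (w + (z0 - z)) + (y - F0 z0).
have zz : z + (z0 - z) = z0 by rewrite addrC subrK.
have q0 : q (F0 z0) = q y by rewrite (nbhs_singleton Ff) z0z.
exists F; split.
- by rewrite /F zz addrC subrK.
- have cs : {for z, continuous (fun w : U => w + (z0 - z))}.
    by apply: cvgD; [exact: cvg_id|exact: cvg_cst].
  have H : \forall w \near z, q (F0 (w + (z0 - z))) = f (p (w + (z0 - z))).
    by have := cs (fun w => q (F0 w) = f (p w)); rewrite zz; apply.
  apply: filterS H => w e; rewrite /F (covering_transl cq)// e.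
  by congr (f _); rewrite (covering_transl cp).
- have ds := is_diff_shift z (z0 - z).
  have dF0 : is_diff (z + (z0 - z)) F0 ('d F0 z0) by rewrite zz; exact: differentiableP.
  have dc := @is_diff_comp _ _ _ _ _ _ _ _ _ ds dF0.
  by have := is_diffD dc (is_diff_cst (y - F0 z0) z); rewrite addr0.
Qed.

(** Near [z] a continuous lift differs by a constant from a differentiable one. In particular the
    differential does not depend on the charts. *)
Lemma has_differential_lift (f : M -> N) (z : U) (F : U -> V) (L : U -> V) :
  has_differential p q f (p z) L -> {for z, continuous F} ->
  (\forall w \near z, q (F w) = f (p w)) -> is_diff z F L.
Proof.
move=> hf cF Ff.
have [G [_ Gf dG]] := has_differential_at hf (nbhs_singleton Ff).
by apply: is_diff_lift cF _ dG; apply: filterS2 Ff Gf => w -> ->.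
Qed.

Lemma has_differential_uniq (f : M -> N) x (L L' : U -> V) :
  has_differential p q f x L -> has_differential p q f x L' -> L = L'.
Proof.
move=> [z [F [<- Ff dF ->]]] hf'.
have [_ <-] // := has_differential_lift hf' (differentiable_continuous dF) Ff.
Qed.

Lemma differentialE (f : M -> N) x (L : U -> V) :
  has_differential p q f x L -> differential p q f x = L.
Proof.
move=> h; apply: (has_differential_uniq _ h).
by apply: getI; exact: h.
Qed.

Lemma differentialP (f : M -> N) : C1 p q f ->
  forall x, has_differential p q f x (differential p q f x).
Proof. by move=> [h _] x; have [L hL] := h x; rewrite (differentialE hL). Qed.

Lemma has_differential_linear (f : M -> N) x (L : U -> V) :
  has_differential p q f x L -> linear L.
Proof. by move=> [z [F [_ _ _ ->]]] a u v; rewrite linearP. Qed.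

Lemma has_differential_continuous (f : M -> N) x (L : U -> V) :
  has_differential p q f x L -> {for x, continuous f}.
Proof.
move=> [z [F [<- Ff dF _]]]; apply: covering_cvg => A; rewrite /= => fA.
have cqF : {for z, continuous (q \o F)}.
  apply: continuous_comp; first exact: differentiable_continuous.
  exact: covering_continuous.
have := cqF A; rewrite /= (nbhs_singleton Ff) => /(_ fA).
by apply: filterS2 Ff => w e /=; rewrite /= e.
Qed.

Lemma C1_continuous (f : M -> N) : C1 p q f -> continuous f.
Proof.
by move=> /differentialP h x; apply: has_differential_continuous (h x).
Qed.

End Covering.

Section Chain.
Context {R : realType} {U V W : normedModType R} {M N P : topologicalType}.
Context {p : U -> M} {q : V -> N} {r : W -> P}.
Hypotheses (cp : covering p) (cq : covering q) (cr : covering r).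

Lemma has_differential_comp (f : M -> N) (g : N -> P) x (L : U -> V)
    (K : V -> W) :
  has_differential p q f x L -> has_differential q r g (f x) K ->
  has_differential p r (g \o f) x (K \o L).
Proof.
move=> [z [F [zx Ff dF LE]]] hg; have Fz := nbhs_singleton Ff.
have [y ry] := covering_surj cr (g (f x)).
rewrite -zx -Fz in hg ry.
have [G [Gy Gg dG]] := has_differential_at cq cr hg ry.
have cF := differentiable_continuous dF.
have dFL : is_diff z F L by rewrite LE; exact: differentiableP.
have dGF := is_diff_comp dFL dG.
exists z, (G \o F); split => //; last by case: dGF => _ ->.
apply: filterS2 Ff (cF _ Gg) => w /= Ffw.
by rewrite -Ffw.
Qed.

Lemma has_differential_id x : has_differential p p id x id.
Proof.
have [z zx] := covering_surj cp x.
exists z, id; split => //; first exact: nearW.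
by have [_ ->] := is_diff_id z.
Qed.

Lemma differential_comp (f : M -> N) (g : N -> P) x :
  C1 p q f -> C1 q r g ->
  differential p r (g \o f) x = differential q r g (f x) \o differential p q f x.
Proof.
move=> cf cg; apply: (differentialE cp cr).
by apply: has_differential_comp; exact: differentialP.
Qed.

End Chain.

(** * The coverings of the circle and of the annulus, and evaluation in the compact-open topology *)

Section AnnulusCover.
Context {R : realType}.
Local Notation A := (annulus R).

Lemma circle_cover_transl (z z' w : R) : circle_cover z = circle_cover z' ->
  circle_cover (w + (z' - z)) = circle_cover w.
Proof.
move=> /circle_coverP zz; apply/circle_coverP.
by rewrite addrC addKr -opprB rpredN.
Qed.

Lemma circle_cover_discrete (y y' : R) :
  circle_cover y = circle_cover y' -> `|y - y'| < 1 -> y = y'.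
Proof.
move=> /circle_coverP /intrP[m ym]; rewrite ym -intr_norm -[1]/(1%:~R) ltr_int => m1.
by apply/eqP; rewrite -subr_eq0 ym; have -> : m = 0 by lia.
Qed.

Lemma circle_cover_surj (x : circle R) : exists z, circle_cover z = x.
Proof. by exists (repr x); rewrite /circle_cover reprK. Qed.

Lemma circle_covering : covering (@circle_cover R).
Proof.
split.
- exact: pi_continuous.
- move=> B oB; rewrite /open /= /quotient_open.
  rewrite (_ : _ @^-1` _ = \bigcup_(m in [set: int]) [set z | B (z + m%:~R)]).
    apply: bigcup_open => m _.
    have : continuous (fun z : R => z + m%:~R).
      by move=> z; apply: cvgD; [exact: cvg_id|exact: cvg_cst].
    by move/continuousP; apply.
  apply/seteqP; split => z /=.
    move=> [w Bw /circle_coverP/intrP[m wz]]; exists m => //=.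
    by rewrite -wz addrC subrK.
  move=> [m _ /= Bz]; exists (z + m%:~R) => //.
  by apply/circle_coverP; rewrite addrAC subrr add0r intr_int.
- exact: circle_cover_surj.
- exact: circle_cover_transl.
- exists 1; first exact: ltr01.
  exact: circle_cover_discrete.
Qed.

Lemma annulus_cover_eq (z z' : R * R) : annulus_cover z = annulus_cover z' <->
  circle_cover z.1 = circle_cover z'.1 /\ z.2 = z'.2.
Proof. by split=> [[]|[e1 e2]]; rewrite /annulus_cover ?e1 ?e2. Qed.

Lemma annulus_covering : covering (@annulus_cover R).
Proof.
split.
- move=> z.
  apply: (@continuous_pair _ _ _ (fun z : R * R => circle_cover z.1) snd);
    last exact: continuous_snd.
  apply: (@continuous_comp _ _ _ fst circle_cover); first exact: continuous_fst.
  exact: (covering_continuous circle_covering).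
- move=> B oB; rewrite openE => _ [z Bz <-]; rewrite /interior.
  have [[B1 B2] [/= n1 n2] BB] : nbhs z B by exact: open_nbhs_nbhs.
  exists (circle_cover @` B1, B2).
    split => //=; apply: (nbhs_covering circle_covering).
    by apply: filterS n1 => y B1y; exists y.
  by move=> [_ y] /= [[x B1x <-] B2y]; exists (x, y) => //; exact: BB.
- move=> [x y]; have [z zx] := circle_cover_surj x.
  by exists (z, y); rewrite /annulus_cover zx.
- move=> z z' w /annulus_cover_eq[e1 e2]; apply/annulus_cover_eq; split => /=.
    exact: circle_cover_transl.
  by rewrite e2 subrr addr0.
- exists 1; first exact: ltr01.
  move=> [y1 y2] [z1 z2] /annulus_cover_eq[/= e1 e2].
  rewrite prod_normE /= gt_max => /andP[h _].
  by rewrite e2 (circle_cover_discrete e1).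
Qed.

Lemma annulus_compact_nbhs (x : A) (B : set A) : nbhs x B ->
  exists K, [/\ nbhs x K, compact K & K `<=` B].
Proof.
have [z <-] := covering_surj annulus_covering x => nB.
have cc := covering_continuous annulus_covering.
have /nbhs_ballP[e /= e0 He] := cc z B nB.
have e2 : 0 < e / 2 by exact: divr_gt0.
pose K := `[z.1 - e / 2, z.1 + e / 2] `*` `[z.2 - e / 2, z.2 + e / 2].
exists (annulus_cover @` K); split.
- apply: (nbhs_covering annulus_covering).
  apply: (@filterS _ _ _ (ball z (e / 2))); last exact: nbhsx_ballx.
  move=> w zw; exists w => //; move: zw => [/=].
  by rewrite -!ball_normE /= !ltr_distl /K /= !in_itv /= => /andP[? ?] /andP[? ?]; split; lra.
- apply: continuous_compact; first by apply: continuous_subspaceT.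
  by apply: compact_setX; exact: segment_compact.
- move=> _ [w Kw <-]; apply: He; move: Kw.
  case; rewrite /= !in_itv /= => /andP[? ?] /andP[? ?].
  by split; rewrite /= -ball_normE /= ltr_distl; lra.
Qed.

(** Separate continuity becomes joint by local compactness: [I t] sends a compact neighbourhood of
    [x] into [G], and so does [I s] for [s] near [t]. *)
Lemma compact_open_eval (T : topologicalType) (V : topologicalType)
    (I : T -> A -> V) (t : T) (x : A) :
  {for t, continuous (I : T -> {compact-open, A -> V})} ->
  {for x, continuous (I t)} ->
  {for (t, x), continuous (fun z : T * A => I z.1 z.2)}.
Proof.
move=> cI cx B; rewrite /= [X in X B -> _]nbhsE => -[G [oG Gx] GB].
have [K [nK cK KG]] := annulus_compact_nbhs (cx G (open_nbhs_nbhs (conj oG Gx))).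
have : \forall s \near t, I s @` K `<=` G.
  have := (@compact_open_cvgP A V _ (I t) _).1 cI; apply => //.
  by move=> _ [y Ky <-]; exact: KG.
move=> nt; exists ([set s | I s @` K `<=` G], K); first by split.
by move=> [s y] /= [sK Ky]; apply: GB; apply: sK; exists y.
Qed.

End AnnulusCover.

(** * The extended isotopy *)

Section Isotopy.
Context {R : realType}.
Local Notation A := (annulus R).
Local Notation vec := (R * R)%type.
Local Notation diffA := (has_differential annulus_cover annulus_cover).
Let cA := @annulus_covering R.

Lemma D_has_differential (f : A -> A) : C1 annulus_cover annulus_cover f ->
  forall x, diffA f x (D f x).
Proof. by move=> cf; exact: differentialP. Qed.

Lemma diffeo1_injective (f : A -> A) : diffeo1 f -> injective f.
Proof. by move=> [_ [g [fK _ _]]]; exact: can_inj fK. Qed.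

(** By the chain rule the differential of the inverse map is a left inverse. *)
Lemma D_injective (f : A -> A) x : diffeo1 f -> injective (D f x).
Proof.
move=> [cf [g [fK _ cg]]]; apply: (@can_inj _ _ _ (D g (f x))) => u.
have gf : g \o f = id by apply/funext => y; exact: fK.
have := differential_comp cA cA cA x cf cg; rewrite gf.
by rewrite (differentialE cA cA (has_differential_id cA x)) => /(congr1 (@^~ u)).
Qed.

Lemma linear_fun0 (L : vec -> vec) : linear L -> L 0 = 0.
Proof.
by move=> Ll; have := Ll (-1) 0 0; rewrite scaler0 addr0 scaleN1r addNr.
Qed.

Lemma linear_decomp (L : vec -> vec) (u : vec) : linear L ->
  L u = u.1 *: L (1, 0) + u.2 *: L (0, 1).
Proof.
move=> Ll; rewrite -[u.2 *: _]addr0.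
rewrite -[X in _ + (_ + X)](linear_fun0 Ll) -Ll -Ll.
congr L; rewrite addr0; case: u => a b /=.
transitivity (a * 1 + b * 0, a * 0 + b * 1); last by [].
by rewrite !mulr1 !mulr0 addr0 add0r.
Qed.

Variables (f : A -> A) (I : R -> A -> A).
Hypothesis isoI : isotopy_from_id f I.

(** An isotopy is constrained on [[0, 1]] only; clamping the time gives a family of diffeomorphisms
    that is continuous on the whole line. *)
Definition clamped_isotopy (t : R) : A -> A := I (clamp 0 1 t).

Local Notation J := clamped_isotopy.

Lemma clamp01 (t : R) : clamp 0 1 t \in `[0, 1]%R.
Proof. by rewrite in_itv /= clamp_itv// ler01. Qed.

Lemma clamped_isotopy_diffeo1 t : diffeo1 (J t).
Proof. by have [[dI _ _] _ _] := isoI; apply: dI; exact: clamp01. Qed.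

Lemma clamped_isotopy_le0 t : t <= 0 -> J t = id.
Proof.
have [_ I0 _] := isoI; move=> t0; rewrite /J /clamp (_ : Num.max _ _ = 0)//.
by rewrite min_r ?max_l// (le_trans t0 ler01).
Qed.

Lemma clamped_isotopy_ge1 t : 1 <= t -> J t = f.
Proof.
have [_ _ I1] := isoI; move=> t1; rewrite /J /clamp (_ : Num.max _ _ = 1)//.
by rewrite min_l// max_r.
Qed.

Lemma clamp_within (T : topologicalType) (h : R -> T) :
  {within `[0, 1], continuous h} -> continuous (h \o clamp 0 1).
Proof.
move=> ch t; have cl := @continuous_clamp R 0 1 t.
have /subspace_continuousP/(_ (clamp 0 1 t) (clamp01 t)) := ch.
move=> hh B /hh; rewrite /= nbhs_simpl /= => nB.
have H : \forall s \near t, [set` `[0, 1]] (clamp 0 1 s) -> B (h (clamp 0 1 s)).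
  exact: cl _ nB.
by apply: filterS H => s; apply; exact: clamp01.
Qed.

Lemma clamped_isotopy_continuous : continuous (fun z : R * A => J z.1 z.2).
Proof.
have [[dI cI _] _ _] := isoI; move=> [t x].
apply: (@compact_open_eval _ _ _ J t x).
  exact: (clamp_within cI).
by apply: (C1_continuous cA cA); case: (clamped_isotopy_diffeo1 t).
Qed.

(** Continuity is assumed for each constant vector; linearity makes it joint in the vector by
    reduction to the standard basis. *)
Lemma D_clamped_isotopy_continuous :
  continuous (fun z : R * A * vec => D (J z.1.1) z.1.2 z.2).
Proof.
have [[dI _ cD] _ _] := isoI.
have cu (u : vec) : continuous (fun z : R * A => D (J z.1) z.2 u).
  move=> [t x]; apply: (@compact_open_eval _ _ _ (fun t x => D (J t) x u) t x).
    exact: (clamp_within (cD u)).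
  by have [[_ h] _] := clamped_isotopy_diffeo1 t; exact: (h u x).
have -> : (fun z : R * A * vec => D (J z.1.1) z.1.2 z.2) =
  (fun z => z.2.1 *: D (J z.1.1) z.1.2 (1, 0) + z.2.2 *: D (J z.1.1) z.1.2 (0, 1)).
  apply/funext => z; apply: linear_decomp.
  have [cJ _] := clamped_isotopy_diffeo1 z.1.1.
  exact: has_differential_linear (D_has_differential cJ z.1.2).
have c1 := @continuous_fst (R * A)%type vec.
have c2 := @continuous_snd (R * A)%type vec.
move=> z; apply: cvgD; apply: cvgZ.
- exact: continuous_comp1 (c2 z).
- exact: (@continuous_comp _ _ _ fst (fun z : R * A => D (J z.1) z.2 (1, 0)) z (c1 z) (cu _ _)).
- exact: continuous_comp2 (c2 z).
- exact: (@continuous_comp _ _ _ fst (fun z : R * A => D (J z.1) z.2 (0, 1)) z (c1 z) (cu _ _)).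
Qed.

(* On [0, n] this is the extended isotopy, but as a composition it is visibly
   continuous across the integers. *)
Fixpoint flow (n : nat) (t : R) : A -> A :=
  if n is m.+1 then J (t - m%:R) \o flow m t else id.

Lemma flow_continuous n : continuous (fun z : R * A => flow n z.1 z.2).
Proof.
elim: n => [|n IH]; first exact: continuous_snd.
move=> z; apply: (@continuous_comp _ _ _
  (fun z : R * A => (z.1 - n%:R, flow n z.1 z.2)) (fun z => J z.1 z.2)).
  apply: continuous_pair; last exact: IH.
  by apply: cvgB; [exact: continuous_fst|exact: cvg_cst].
exact: clamped_isotopy_continuous.
Qed.

Lemma flow_diff n t x : diffA (flow n t) x (D (flow n t) x).
Proof.
elim: n => [|n IH].
  rewrite /D (differentialE cA cA (has_differential_id cA x)).
  exact: (has_differential_id cA x).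
have [cJ _] := clamped_isotopy_diffeo1 (t - n%:R).
have h := has_differential_comp cA cA IH (D_has_differential cJ (flow n t x)).
rewrite /D -/(flow n.+1 t) in h *.
by rewrite (differentialE cA cA h).
Qed.

Lemma D_flowS n t x : D (flow n.+1 t) x = D (J (t - n%:R)) (flow n t x) \o D (flow n t) x.
Proof.
have [cJ _] := clamped_isotopy_diffeo1 (t - n%:R).
apply: (differentialE cA cA).
exact: has_differential_comp (flow_diff n t x) (D_has_differential cJ _).
Qed.

Lemma D_flow_linear n t x : linear (D (flow n t) x).
Proof. exact: has_differential_linear (flow_diff n t x). Qed.

Lemma D_flow_continuous n :
  continuous (fun z : R * A * vec => D (flow n z.1.1) z.1.2 z.2).
Proof.
elim: n => [|n IH].
  rewrite (_ : (fun z : R * A * vec => _) = snd); first exact: continuous_snd.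
  apply/funext => z /=.
  by rewrite /D (differentialE cA cA (has_differential_id cA z.1.2)).
rewrite (_ : (fun z : R * A * vec => _) = (fun z => D (J (z.1.1 - n%:R))
    (flow n z.1.1 z.1.2) (D (flow n z.1.1) z.1.2 z.2))); last first.
  by apply/funext => z; rewrite D_flowS.
move=> z; apply: (@continuous_comp _ _ _ (fun z : R * A * vec =>
   ((z.1.1 - n%:R, flow n z.1.1 z.1.2), D (flow n z.1.1) z.1.2 z.2))
   (fun z => D (J z.1.1) z.1.2 z.2)); last exact: D_clamped_isotopy_continuous.
apply: continuous_pair; last exact: IH.
apply: continuous_pair.
  apply: cvgB; last exact: cvg_cst.
  by apply: continuous_comp1; exact: continuous_fst.
apply: (@continuous_comp _ _ _ fst (fun z : R * A => flow n z.1 z.2)).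
  exact: continuous_fst.
exact: flow_continuous.
Qed.

Lemma flow_injective n t : injective (flow n t).
Proof.
elim: n => [|n IH]; first exact: inj_id.
apply: inj_comp; last exact: IH.
exact: diffeo1_injective (clamped_isotopy_diffeo1 _).
Qed.

Lemma D_flow_injective n t x : injective (D (flow n t) x).
Proof.
elim: n => [|n IH].
  rewrite /D (differentialE cA cA (has_differential_id cA x)); exact: inj_id.
rewrite D_flowS; apply: inj_comp; last exact: IH.
exact: D_injective (clamped_isotopy_diffeo1 _).
Qed.

Lemma flow_ge n t : n%:R <= t -> flow n t = iter n f.
Proof.
elim: n => // n IH nt; apply/funext => x /=.
rewrite IH; last by rewrite (le_trans _ nt)// ler_nat.
by rewrite clamped_isotopy_ge1// lerBrDr nat1r.
Qed.

(** The right end is included: at [t = m.+1] the next piece starts with [I 0 = id], and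
    [J 1 = f]. *)
Lemma extend_isotopy_step m t : m%:R <= t <= m.+1%:R ->
  extend_isotopy I t = J (t - m%:R) \o iter m f.
Proof.
have [_ I0 I1] := isoI.
move=> /andP[mt]; rewrite le_eqVlt => /orP[/eqP ->|tm].
  rewrite /extend_isotopy natrK subrr I0 I1 clamped_isotopy_ge1//.
  by rewrite -natr1 addrAC subrr add0r.
rewrite /extend_isotopy (_ : Num.truncn t = m); last first.
  by apply: truncn_def; rewrite mt.
rewrite I1 /J clamp_id// subr_ge0 mt/= lerBlDr addrC natr1.
exact: ltW.
Qed.

Lemma flow_extend n t : 0 <= t <= n%:R -> flow n t = extend_isotopy I t.
Proof.
have [_ I0 I1] := isoI.
elim: n => [|n IH] /andP[t0 tn].
  have -> : t = 0%:R by apply/eqP; rewrite eq_le t0 andbT.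
  by rewrite /extend_isotopy natrK subrr I0.
have [tn'|nt] := leP t n%:R.
  by rewrite /= clamped_isotopy_le0 ?subr_le0//= IH ?t0.
rewrite (@extend_isotopy_step n) ?tn ?ltW//=.
by rewrite flow_ge// ltW.
Qed.

End Isotopy.

(** * Rotation of vectors under a path of linear maps *)

Section Order.
Context {R : realType}.
Local Notation vec := (R * R)%type.
Implicit Types u v : vec.

(** The duplication formulas reduce this to [turn_inj_int]: the sine vanishes exactly when the
    doubled angle is a whole number of turns. *)
Lemma sin_turn_eq0 (x : R) : (sin (x * (pi *+ 2)) == 0) = (2 * x \is a Num.int).
Proof.
have e : cos (2 * x * (pi *+ 2)) = 1 - 2 * sin (x * (pi *+ 2)) ^+ 2.
  rewrite (_ : 2 * x * _ = (x * (pi *+ 2)) *+ 2); last by rewrite -[RHS]mulr_natl mulrA.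
  by rewrite cos_mulr2n cos2sin2; ring.
have t0 : turn (0 : R) = (0, 1) by rewrite /turn mul0r sin0 cos0 oppr0.
apply/eqP/idP => [s0|/intrP[m xm]].
  rewrite -[2 * x]subr0; apply: turn_inj_int; rewrite t0 /turn e s0.
  rewrite expr0n /= mulr0 subr0.
  rewrite (_ : 2 * x * _ = (x * (pi *+ 2)) *+ 2); last by rewrite -[RHS]mulr_natl mulrA.
  by rewrite sin_mulr2n s0 mulr0 mul0rn oppr0.
have := turnD_int (0 : R) m; rewrite add0r -xm t0 /turn e => -[_ e1].
apply/eqP; rewrite -sqrf_eq0; apply/eqP; lra.
Qed.

Lemma cross_eq0 a b u v : has_angle a u -> has_angle b v ->
  (cross u v == 0) = (2 * (b - a) \is a Num.int).
Proof.
move=> [r r0 ->] [s s0 ->]; rewrite -sin_turn_eq0.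
have -> : cross (r *: turn a) (s *: turn b) = (r * s) * sin ((b - a) * (pi *+ 2)).
  rewrite mulrBl sinB /cross /turn /= /GRing.scale /=; ring.
by rewrite mulf_eq0 gt_eqF ?mulr_gt0.
Qed.

(** The factor is the determinant of [L]. *)
Lemma cross_linear (L : vec -> vec) u v : linear L ->
  cross (L u) (L v) = cross (L (1, 0)) (L (0, 1)) * cross u v.
Proof.
move=> Ll; rewrite (linear_decomp u Ll) (linear_decomp v Ll) /cross /=.
rewrite /GRing.scale /=; ring.
Qed.

(** With columns [p] and [q] and zero determinant, the kernel would contain [(q.2, - p.2)] and
    [(q.1, - p.1)]; both would be 0, and then so would [L]. *)
Lemma cross_injective (L : vec -> vec) : linear L -> injective L ->
  cross (L (1, 0)) (L (0, 1)) != 0.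
Proof.
move=> Ll Li; apply/eqP => c0.
set p := L (1, 0) in c0; set q := L (0, 1) in c0.
have L0 (a b : R) : a *: p + b *: q = 0 -> a = 0 /\ b = 0.
  move=> h; have : L (a, b) = L 0.
    by rewrite (linear_decomp (a, b) Ll) (linear_fun0 Ll).
  by move/Li => [].
have [] := L0 q.2 (- p.2).
  rewrite [LHS]surjective_pairing /= /GRing.scale /=.
  by congr (_, _); [rewrite -[RHS]c0 /cross|]; ring.
move=> q2 /eqP; rewrite oppr_eq0 => /eqP p2.
have [] := L0 q.1 (- p.1).
  rewrite [LHS]surjective_pairing /= /GRing.scale /=.
  by congr (_, _); [|rewrite q2 p2]; ring.
move=> q1 /eqP; rewrite oppr_eq0 => /eqP p1.
have [] := L0 1 0; last by move/eqP; rewrite oner_eq0.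
by rewrite scale0r addr0 scale1r [p]surjective_pairing p1 p2.
Qed.

(* Two vectors moved by injective linear maps cannot cross each other's line. *)
Lemma angle_order (L : R -> vec -> vec) u v (a b : R -> R) (s t : R) (k : int) :
  s <= t -> (forall x, s <= x <= t -> linear (L x)) ->
  (forall x, s <= x <= t -> injective (L x)) ->
  {within `[s, t], continuous a} -> {within `[s, t], continuous b} ->
  (forall x, s <= x <= t -> has_angle (a x) (L x u)) ->
  (forall x, s <= x <= t -> has_angle (b x) (L x v)) ->
  b s - a s <= k%:~R / 2 -> b t - a t <= k%:~R / 2.
Proof.
move=> st Ll Li ca cb ha hb bas; rewrite leNgt; apply/negP => bat.
pose d x := b x - a x.
have cd : {within `[s, t], continuous d}.
  by move=> x; apply: cvgB; [exact: cb|exact: ca].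
have dP x : s <= x <= t -> (cross u v == 0) = (2 * d x \is a Num.int).
  move=> xst; rewrite -(cross_eq0 (ha x xst) (hb x xst)) cross_linear;
    last exact: Ll.
  rewrite mulf_eq0 (negbTE (cross_injective _ _))//; [exact: Ll|exact: Li].
(* For parallel vectors [2 * d] is an integer throughout, hence constant. Otherwise [d] would have
   to pass through [k / 2], where the images are parallel. *)
have [uv0|uv0] := boolP (cross u v == 0).
  have : 2 * d s = 2 * d t.
    apply: (@int_valued_const _ (fun x => 2 * d x)) => //.
      by move=> x; apply: cvgMr; exact: cd.
    by move=> x xst; rewrite -dP.
  by rewrite /d; lra.
have [|x xst dx] := @IVT _ d s t (k%:~R / 2) st cd.
  have dd : d s <= d t by rewrite /d; lra.
  by rewrite (min_l dd) (max_r dd) bas ltW.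
move: uv0; rewrite (dP x); last by move: xst; rewrite in_itv.
by rewrite dx mulrC divfK// intr_int.
Qed.

(** Rounding the initial difference up to a multiple of a half turn costs less than a half turn and
    gives a bound that [angle_order] propagates. *)
Lemma angle_variation_cmp (L : R -> vec -> vec) u v (a b : R -> R) (s t : R) :
  s <= t -> (forall x, s <= x <= t -> linear (L x)) ->
  (forall x, s <= x <= t -> injective (L x)) ->
  {within `[s, t], continuous a} -> {within `[s, t], continuous b} ->
  (forall x, s <= x <= t -> has_angle (a x) (L x u)) ->
  (forall x, s <= x <= t -> has_angle (b x) (L x v)) ->
  b t - b s <= a t - a s + 1.
Proof.
move=> st Ll Li ca cb ha hb.
pose k := Num.ceil (2 * (b s - a s)).
have h : b t - a t <= k%:~R / 2.
  apply: angle_order Ll Li ca cb ha hb _ => //.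
  by rewrite ler_pdivlMr// mulrC ceil_ge.
have : (k%:~R : R) < 2 * (b s - a s) + 1.
  by rewrite -ltrBlDr -[1]/(1%:~R) -intrB gt_pred_ceil.
lra.
Qed.

End Order.

(** * Angles along the extended isotopy, and their upper barriers under negative torsion *)

Section Torsion.
Context {R : realType}.
Local Notation A := (annulus R).
Local Notation vec := (R * R)%type.
Variables (f : A -> A) (I : R -> A -> A).
Hypothesis isoI : isotopy_from_id f I.
Local Notation flow := (flow I).
Local Notation J := (clamped_isotopy I).

Lemma exists_angle1 (a b : R) (w : R -> vec) : a <= 0 <= b ->
  (forall t, w (clamp a b t) = w t) -> continuous w -> (forall t, w t != 0) ->
  exists2 v : R -> R, continuous v & forall t, has_angle (v t) (w t).
Proof.
move=> /andP[a0 b0] wc cw w0.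
apply: (@exists_angle R R `[a, b] (clamp a b)) => //.
- exact: segment_compact.
- move=> p t /=; rewrite !in_itv /= => /andP[ap pb] /andP[t0 t1].
  by rewrite /GRing.scale /=; apply/andP; split; nra.
- exact: continuous_clamp.
- by move=> p /=; rewrite in_itv /= clamp_itv// (le_trans a0).
Qed.

Lemma flow_le0 n t : t <= 0 -> flow n t = id.
Proof.
move=> t0; elim: n => // n IH; rewrite /= IH (clamped_isotopy_le0 isoI)//.
by rewrite subr_le0 (le_trans t0).
Qed.

Lemma flow_clamp n t : flow n (clamp 0 n%:R t) = flow n t.
Proof.
have n0 : 0 <= n%:R :> R by [].
rewrite /clamp; case: (leP n%:R t) => nt.
  by rewrite (max_r n0) !(flow_ge isoI).
by case: (leP 0 t) => // t0; rewrite !flow_le0// ltW.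
Qed.

Lemma D_flow_neq0 n t x (xi : vec) : xi != 0 -> D (flow n t) x xi != 0.
Proof.
apply: contra => /eqP; rewrite -[RHS](linear_fun0 (D_flow_linear isoI n t x)).
by move=> /(D_flow_injective isoI) ->.
Qed.

Lemma flow_angle n x (xi : vec) : xi != 0 ->
  exists2 v : R -> R, continuous v &
    forall t, has_angle (v t) (D (flow n t) x xi).
Proof.
move=> xi0; apply: (@exists_angle1 0 n%:R).
- by rewrite lexx ler0n.
- by move=> t; rewrite flow_clamp.
- move=> t; apply: (@continuous_comp _ _ _ (fun t => ((t, x), xi))
    (fun z : R * A * vec => D (flow n z.1.1) z.1.2 z.2)).
    apply: continuous_pair; last exact: cvg_cst.
    by apply: continuous_pair; [exact: cvg_id|exact: cvg_cst].
  exact: (D_flow_continuous isoI).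
- by move=> t; exact: D_flow_neq0.
Qed.

Lemma D_extend_neq0 t x (xi : vec) : 0 <= t -> xi != 0 ->
  D (extend_isotopy I t) x xi != 0.
Proof.
move=> t0 xi0; rewrite -(flow_extend isoI (n := (Num.truncn t).+1)).
  exact: D_flow_neq0.
by rewrite t0 ltW// truncnS_gt.
Qed.

Lemma D_id x (xi : vec) : D (id : A -> A) x xi = xi.
Proof.
have cA := @annulus_covering R.
by rewrite /D (differentialE cA cA (has_differential_id cA x)).
Qed.

(** Angles [a n] along [flow n], all normalised to [a0] at time 0, agree on common intervals by
    uniqueness and can be glued. *)
Lemma angle_lift_exists x (xi : vec) : xi != 0 ->
  exists v, angle_lift I x xi v.
Proof.
move=> xi0; have [a0 ha0] : exists a, has_angle a xi.
  by eexists; exact: has_angle_polar.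
have [a ha] : {a : nat -> R -> R & forall n, [/\ continuous (a n), a n 0 = a0 &
        forall t, has_angle (a n t) (D (flow n t) x xi)]}.
  apply: (@choice _ _ (fun n v => [/\ continuous v, v 0 = a0 &
        forall t, has_angle (v t) (D (flow n t) x xi)])) => n.
  have [v cv hv] := flow_angle n x xi0.
  exists (fun t => v t + (a0 - v 0)); split; last 2 first.
  - by rewrite addrC subrK.
  - move=> t; apply: has_angle_shift (hv t).
    rewrite opprD addrA subrr add0r opprB; apply: has_angle_eq ha0.
    by have := hv 0; rewrite flow_le0// D_id.
  - by move=> t; apply: cvgD; [exact: cv|exact: cvg_cst].
have aE m n t : 0 <= t -> t <= m%:R -> t <= n%:R -> a m t = a n t.
  move=> t0 tm tn; have [cm m0 hm] := ha m; have [cn n0 hn] := ha n.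
  apply: (@addIr _ (- a0)); rewrite -{1}m0 -n0.
  apply: (@angle_variation_uniq _ _ _ (fun t => D (extend_isotopy I t) x xi)) => //.
  - exact: continuous_subspaceT.
  - exact: continuous_subspaceT.
  - move=> s /andP[s0 st]; rewrite -(flow_extend isoI (n := m))//.
    by rewrite s0 (le_trans st).
  - move=> s /andP[s0 st]; rewrite -(flow_extend isoI (n := n))//.
    by rewrite s0 (le_trans st).
pose v t := a (Num.truncn t).+1 t.
have vE n t : 0 <= t -> t <= n%:R -> v t = a n t.
  by move=> t0 tn; apply: aE => //; rewrite ltW// truncnS_gt.
exists v; split; last first.
  move=> t t0; apply/theta_chiP; first exact: D_extend_neq0.
  have [_ _ hn] := ha (Num.truncn t).+1.
  rewrite -(flow_extend isoI (n := (Num.truncn t).+1)); first exact: hn.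
  by rewrite t0 ltW// truncnS_gt.
apply/subspace_continuousP => t; rewrite /= in_itv /= andbT => t0.
(* As [n] strictly exceeds [t], the glued function is [a n] near [t] in the half-line, even at
   integers. *)
pose n := (Num.truncn t).+1; have tn : t < n%:R by exact: truncnS_gt.
have [cn _ _] := ha n.
have cw : a n s @[s --> within `[0, +oo[ (nbhs t)] --> a n t.
  exact: cvg_within_filter (cn t).
have vt : v t = a n t by apply: vE => //; exact: ltW.
rewrite /from_subspace vt; apply: cvg_trans cw; apply: near_eq_cvg.
have nt : \forall s \near t, s < n%:R by exact: lt_nbhsl.
apply: filterS nt => s sn; rewrite /= in_itv /= andbT => s0.
by rewrite (vE n)// ltW.
Qed.

Lemma vtildeP x (xi : vec) : xi != 0 ->
  {within `[0, +oo[, continuous (vtilde I x xi)} /\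
  forall t, 0 <= t -> has_angle (vtilde I x xi t) (D (extend_isotopy I t) x xi).
Proof.
move=> xi0; have [v hv] := angle_lift_exists x xi0.
have [cv av] : angle_lift I x xi (vtilde I x xi) by apply: getI; exact: hv.
split=> // t t0; apply/theta_chiP; [exact: D_extend_neq0|exact: av].
Qed.

Lemma vtilde_within x (xi : vec) (s t : R) : xi != 0 -> 0 <= s ->
  {within `[s, t], continuous (vtilde I x xi)}.
Proof.
move=> xi0 s0; apply: continuous_subspaceW (vtildeP x xi0).1.
by move=> y /=; rewrite !in_itv /= andbT => /andP[sy _]; exact: le_trans sy.
Qed.

Definition rotation (n : nat) (x : A) (xi : vec) : R :=
  vtilde I x xi n%:R - vtilde I x xi 0.

(** This carries bounds on the rotation from one vector at [x] to all others, as [has_torsion]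
    demands. *)
Lemma rotation_cmp n x (xi xi' : vec) : xi != 0 -> xi' != 0 ->
  rotation n x xi' <= rotation n x xi + 1.
Proof.
move=> xi0 xi'0.
have [_ h] := vtildeP x xi0; have [_ h'] := vtildeP x xi'0.
apply: (@angle_variation_cmp _ (fun t => D (extend_isotopy I t) x) xi xi').
- by [].
- move=> t tn; rewrite -(flow_extend isoI tn); exact: (D_flow_linear isoI).
- move=> t tn; rewrite -(flow_extend isoI tn); exact: (D_flow_injective isoI).
- exact: vtilde_within.
- exact: vtilde_within.
- by move=> t /andP[t0 _]; exact: h.
- by move=> t /andP[t0 _]; exact: h'.
Qed.

Hypothesis neg : forall z, vtilde I z chi 1 < vtilde I z chi 0.

Lemma chi_neq0 : chi != 0 :> vec.
Proof. by apply/eqP => -[/eqP]; rewrite oner_eq0. Qed.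

Lemma turn0 : turn (0 : R) = chi.
Proof. by rewrite /turn mul0r sin0 cos0 oppr0. Qed.

Lemma has_angle_chi (a : R) : has_angle a chi -> a \is a Num.int.
Proof.
move=> h; rewrite -[a]subr0; apply: has_angle_eq h _.
by exists 1; rewrite ?ltr01// turn0 scale1r.
Qed.

(** Between times [m] and [m.+1] the moved vector is compared with the vertical vector at
    [y = iter m f x], which turns clockwise over that unit of time. *)
Lemma vtilde_decr m x (xi : vec) (k : int) : xi != 0 ->
  vtilde I x xi m%:R <= k%:~R / 2 -> vtilde I x xi m.+1%:R <= k%:~R / 2.
Proof.
move=> xi0 hk.
pose y := iter m f x; pose eta := D (iter m f) x xi.
have fm : iter m f = flow m m%:R by rewrite (flow_ge isoI).
have [_ hx] := vtildeP x xi0; have [_ hy] := vtildeP y chi_neq0.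
have ext0 t : 0 <= t <= 1 -> extend_isotopy I t = J t.
  by move=> t01; rewrite (@extend_isotopy_step _ _ _ isoI 0)// subr0.
have extm t : 0 <= t <= 1 ->
    D (extend_isotopy I (m%:R + t)) x xi = D (J t) y eta.
  move=> /andP[t0 t1]; rewrite (@extend_isotopy_step _ _ _ isoI m); last first.
    by rewrite lerDl t0 -natr1 lerD2l.
  have cA := @annulus_covering R.
  have [cJ _] := clamped_isotopy_diffeo1 isoI t.
  rewrite addrAC subrr add0r /eta /y fm /D.
  by rewrite (differentialE cA cA (has_differential_comp cA cA
    (flow_diff isoI m m%:R x) (D_has_differential cJ _))).
have /intrP[j j0] : vtilde I y chi 0 \is a Num.int.
  apply: has_angle_chi; have := hy 0 (lexx 0).
  by rewrite ext0 ?lexx ?ler01// (clamped_isotopy_le0 isoI)// D_id.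
(* The vertical starts at the integer angle [j] and ends below it, so a bound [k / 2 - j] on the
   difference, preserved by [angle_order], gives the bound [k / 2]. *)
suff : vtilde I x xi (m%:R + 1) - vtilde I y chi 1 <= (k - 2 * j)%:~R / 2.
  by have := neg y; rewrite natr1 intrB intrM j0; lra.
apply: (@angle_order _ (fun t => D (J t) y) chi eta (vtilde I y chi)
  (fun t => vtilde I x xi (m%:R + t)) 0 1) => //.
- move=> t _; have [cJ _] := clamped_isotopy_diffeo1 isoI t.
  exact: has_differential_linear (D_has_differential cJ y).
- by move=> t _; exact: D_injective (clamped_isotopy_diffeo1 isoI t).
- by apply: vtilde_within => //; exact: chi_neq0.
- apply/subspace_continuousP => t /=; rewrite in_itv /= => /andP[t0 t1].
  have /subspace_continuousP cv := @vtilde_within x xi m%:R (m%:R + 1) xi0 (ler0n R m).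
  have /cv {}cv : [set` `[m%:R, m%:R + 1]] (m%:R + t).
    by rewrite /= in_itv /= lerDl t0 lerD2l.
  move=> B /cv; rewrite /= nbhs_simpl /= => nB.
  have cD : {for t, continuous (fun s : R => m%:R + s)}.
    by apply: cvgD; [exact: cvg_cst|exact: cvg_id].
  have H : \forall s \near t, [set` `[m%:R, m%:R + 1]] (m%:R + s) ->
      B (vtilde I x xi (m%:R + s)) by exact: cD _ nB.
  apply: filterS H => s; rewrite /= !in_itv /= => hs /andP[s0 s1]; apply: hs.
  by rewrite lerDl s0 lerD2l.
- move=> t t01; rewrite -ext0//; apply: hy; by case/andP: t01.
- move=> t t01; rewrite -extm//; apply: hx; case/andP: t01 => t0 _.
  by rewrite addr_ge0.
- by rewrite addr0 j0 intrB intrM; lra.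
Qed.

Lemma vtilde_mono m n x (xi : vec) (k : int) : xi != 0 -> (m <= n)%N ->
  vtilde I x xi m%:R <= k%:~R / 2 -> vtilde I x xi n%:R <= k%:~R / 2.
Proof.
move=> xi0 /subnK <-; elim: (n - m)%N => // d IH h.
by rewrite addSn; apply: vtilde_decr => //; exact: IH.
Qed.

End Torsion.

(** * Chords of the moved curve *)

Section Secant.
Context {R : realType}.

Lemma is_derive_fst (U V : normedModType R) (F : R -> U * V) (L : R -> U * V) (s : R) :
  is_diff s F L -> is_derive s (1 : R) (fun x => (F x).1) (L 1).1.
Proof.
move=> dF.
have dfst : is_diff (F s) (@fst U V) (@fst U V).
  have cf : continuous (@fst U V : {linear (U * V)%type -> U}) by exact: continuous_fst.
  apply: DiffDef; first exact: linear_differentiable.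
  exact: (diff_lin _ cf).
have [d1 e1] := @is_diff_comp _ _ _ _ _ _ _ _ _ dF dfst.
apply: DeriveDef; first exact: diff_derivable.
by rewrite deriveE// e1.
Qed.

Lemma is_derive_snd (U V : normedModType R) (F : R -> U * V) (L : R -> U * V) (s : R) :
  is_diff s F L -> is_derive s (1 : R) (fun x => (F x).2) (L 1).2.
Proof.
move=> dF.
have dsnd : is_diff (F s) (@snd U V) (@snd U V).
  have cf : continuous (@snd U V : {linear (U * V)%type -> V}) by exact: continuous_snd.
  apply: DiffDef; first exact: linear_differentiable.
  exact: (diff_lin _ cf).
have [d1 e1] := @is_diff_comp _ _ _ _ _ _ _ _ _ dF dsnd.
apply: DeriveDef; first exact: diff_derivable.
by rewrite deriveE// e1.
Qed.

Variables (g w : R * R -> R).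

(** At [(h, (t, s))], the difference quotient of [g (t, _)] with step [h], completed at [h = 0] by
    the derivative [w]. *)
Definition secant (z : R * (R * R)) : R :=
  if z.1 == 0 then w z.2
  else (g (z.2.1, z.2.2 + z.1) - g z.2) / z.1.

Hypotheses (cg : continuous g) (cw : continuous w).
Hypothesis dg : forall t s : R, -1 < s < 3 ->
  is_derive s (1 : R) (fun x => g (t, x)) (w (t, s)).

Lemma secant_mean h t s : 0 <= h <= 1 -> 0 <= s <= 1 ->
  exists2 x, s <= x <= s + h & secant (h, (t, s)) = w (t, x).
Proof.
move=> /andP[h0 h1] /andP[s0 s1]; rewrite /secant /=; case: eqP => [->|/eqP hn].
  by exists s; rewrite // addr0 lexx.
have hp : 0 < h by rewrite lt_neqAle eq_sym hn.
have cgt : continuous (fun x => g (t, x)).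
  move=> x; apply: (@continuous_comp _ _ _ (fun x => (t, x)) g); last exact: cg.
  by apply: continuous_pair; [exact: cvg_cst|exact: cvg_id].
have [|x||x xsh e] := @MVT R (fun x => g (t, x)) (fun x => w (t, x)) s (s + h).
- by rewrite ltrDl.
- by rewrite in_itv /= => /andP[sx xh]; apply: dg; lra.
- exact: continuous_subspaceT.
exists x; first by move: xsh; rewrite in_itv /= => /andP[sx xh]; rewrite !ltW.
by rewrite e addrAC subrr add0r mulfK.
Qed.

(** Only step 0 is delicate: there the mean value theorem writes nearby quotients as values of [w]
    at nearby points, and continuity of [w] concludes. *)
Lemma secant_continuous (T : topologicalType) (Z : T -> R * (R * R)) (p : T) :
  (forall q, 0 <= (Z q).1 <= 1) -> (forall q, 0 <= (Z q).2.2 <= 1) ->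
  {for p, continuous Z} -> {for p, continuous (secant \o Z)}.
Proof.
move=> Zh Zs cZ.
have c1 : {for p, continuous (fun q => (Z q).1)} by exact: continuous_comp1.
have c2 : {for p, continuous (fun q => (Z q).2)} by exact: continuous_comp2.
have c21 : {for p, continuous (fun q => (Z q).2.1)} by exact: continuous_comp1.
have c22 : {for p, continuous (fun q => (Z q).2.2)} by exact: continuous_comp2.
have [h0|hn] := eqVneq (Z p).1 0; last first.
  have H : {for p, continuous (fun q =>
      (g ((Z q).2.1, (Z q).2.2 + (Z q).1) - g (Z q).2) / (Z q).1)}.
    apply: cvgM; last by apply: cvgV.
    apply: cvgB.
      apply: (@continuous_comp _ _ _ (fun q => ((Z q).2.1, (Z q).2.2 + (Z q).1)) g);
        last exact: cg.
      by apply: continuous_pair => //; apply: cvgD.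
    by apply: (@continuous_comp _ _ _ (fun q => (Z q).2) g) => //; exact: cg.
  have ep : (g ((Z p).2.1, (Z p).2.2 + (Z p).1) - g (Z p).2) / (Z p).1 = secant (Z p).
    by rewrite /secant (negbTE hn).
  suff : secant (Z q) @[q --> p] --> secant (Z p) by [].
  rewrite -ep; apply: cvg_trans H; apply: near_eq_cvg.
  have : \forall q \near p, (Z q).1 != 0.
    by apply: (c1 [set x | x != 0]); apply: open_nbhs_nbhs; split => //; exact: open_neq.
  by apply: filterS => q qn; rewrite /secant /= (negbTE qn).
move=> B /=; rewrite {1}/secant h0 eqxx => nB.
have /nbhs_ballP[e /= e0 He] := cw nB.
have e2 : 0 < e / 2 by exact: divr_gt0.
have n1 : \forall q \near p, ball (Z p).1 (e / 2) (Z q).1.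
  exact: (c1 _ (nbhsx_ballx _ _ e2)).
have n21 : \forall q \near p, ball (Z p).2.1 (e / 2) (Z q).2.1.
  exact: (c21 _ (nbhsx_ballx _ _ e2)).
have n22 : \forall q \near p, ball (Z p).2.2 (e / 2) (Z q).2.2.
  exact: (c22 _ (nbhsx_ballx _ _ e2)).
apply: filterS3 n1 n21 n22 => q; rewrite h0 -!ball_normE /= => b1 b2 b3.
have [x /andP[sx xs]] := secant_mean (Z q).2.1 (Zh q) (Zs q).
rewrite -!surjective_pairing => ->; apply: He.
move: b1 b2 b3; rewrite !ltr_distl => b1 b2 b3.
by split; rewrite /= -ball_normE /= ltr_distl; lra.
Qed.

End Secant.

(** * Lifting circle-valued maps, and contracting curves with a closed lift *)

Section CircleLift.
Context {R : realType}.

Lemma has_angle_turn (a b : R) : has_angle a (turn b) -> a - b \is a Num.int.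
Proof.
by move=> h; apply: has_angle_eq h _; exists 1; rewrite ?ltr01// scale1r.
Qed.

Lemma turn_continuous : continuous (@turn R).
Proof.
move=> a; have cM : {for a, continuous (fun a : R => a * (pi *+ 2))}.
  by apply: cvgMl; exact: cvg_id.
apply: (@continuous_pair _ _ _ (fun a : R => - sin (a * (pi *+ 2)))
  (fun a : R => cos (a * (pi *+ 2)))).
  by apply: cvgN; apply: (continuous_comp cM); exact: continuous_sin.
by apply: (continuous_comp cM); exact: continuous_cos.
Qed.

(** Since [turn] is periodic, [turn (repr (h p))] is continuous although [repr] need not be; a
    continuous angle of this unit vector is a lift of [h]. *)
Lemma exists_circle_lift (V : normedModType R) (K : set V) (c : V -> V)
    (h : V -> circle R) :
  compact K -> (forall p (t : R), K p -> 0 <= t <= 1 -> K (t *: p)) ->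
  continuous c -> (forall p, K (c p)) -> (forall p, h (c p) = h p) ->
  continuous h ->
  exists2 g : V -> R, continuous g & forall p, circle_cover (g p) = h p.
Proof.
move=> cK Kstar cc Kc hc ch.
have reprK' (x : circle R) : circle_cover (repr x) = x.
  by rewrite /circle_cover reprK.
pose w (p : V) : R * R := turn (repr (h p)).
have cw : continuous w.
  move=> p; apply: (@continuous_comp _ _ _ h (fun x : circle R => turn (repr x))).
    exact: ch.
  have [z <-] := circle_cover_surj (h p); apply: (covering_cvg circle_covering).
  rewrite (_ : _ \o _ = @turn R); first exact: turn_continuous.
  apply/funext => x /=.
  have /intrP[m e] : repr (circle_cover x) - x \is a Num.int.
    by apply/circle_coverP; exact: reprK'.
  by rewrite -(turnD_int x m) -e addrC subrK.
have [||a ca ha] := @exists_angle R V K c w cK Kstar cc Kc _ cw.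
- by move=> p; rewrite /w hc.
- move=> p; have := @turn_neq0 R (repr (h p)).
  by move/eqP.
exists a => // p; rewrite -(reprK' (h p)); apply/circle_coverP.
exact: has_angle_turn.
Qed.

Lemma compact_box (a b c d : R) : compact (`[a, b] `*` `[c, d]).
Proof. by apply: compact_setX; exact: segment_compact. Qed.

(** A closed lift shrinks linearly to the origin of the plane, and the projection is a null
    homotopy. The circle is parametrised by the representative [fr] in [[0, 1[]. *)
Lemma null_homotopic_lift (gamma : circle R -> annulus R) (g : R -> R * R) :
  continuous g ->
  (forall s, -1 <= s <= 3 -> annulus_cover (g s) = gamma (circle_cover s)) ->
  (forall s, -1 <= s <= 2 -> g (s + 1) = g s) ->
  null_homotopic gamma.
Proof.
move=> cg gE g1.
pose fr (x : circle R) : R := repr x - (Num.floor (repr x))%:~R.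
have frE x : circle_cover (fr x) = x.
  rewrite -[RHS](reprK x); apply/circle_coverP.
  by rewrite /fr addrAC subrr add0r rpredN intr_int.
have fr01 x : 0 <= fr x < 1.
  by rewrite subr_ge0 ltrBlDl floor_le//= -[1]/(1%:~R) -intrD floorD1_gt.
(* Near the seam [fr] jumps by 1, which [g] does not see; this gives continuity there. *)
have gfr s : -1 < s < 1 -> g (fr (circle_cover s)) = g s.
  move=> s1; have /intrP[m e] : fr (circle_cover s) - s \is a Num.int.
    by apply/circle_coverP; exact: frE.
  have f01 := fr01 (circle_cover s).
  have : (-1)%:~R < m%:~R :> R by rewrite -e; lra.
  have : m%:~R < 2%:~R :> R by rewrite -e; lra.
  rewrite !ltr_int => m2 m1.
  have [m0|m1'] : m = 0 \/ m = 1 by lia.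
    by congr g; apply/eqP; rewrite -subr_eq0 e m0.
  rewrite -(g1 s); last lra.
  by congr g; apply/eqP; rewrite -subr_eq0 opprD addrA e m1' subrr.
pose h (z : R * R) : annulus R := annulus_cover ((1 - z.2) *: g z.1).
have ch : continuous h.
  move=> z; apply: (@continuous_comp _ _ _ (fun z : R * R => (1 - z.2) *: g z.1) annulus_cover).
    apply: cvgZ.
      by apply: cvgB; [exact: cvg_cst|exact: continuous_snd].
    by apply: (@continuous_comp _ _ _ fst g); [exact: continuous_fst|exact: cg].
  exact: (covering_continuous annulus_covering).
exists (fun xr => h (fr xr.1, xr.2)); split.
- apply: continuous_subspaceT => -[x r] B /= nB.
  have [[B1 B2] [/= n1 n2] BB] := ch (fr x, r) B nB.
  exists (circle_cover @` (B1 `&` [set s | -1 < s < 1]), B2).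
    split => //=; rewrite -{1}(frE x); apply: (nbhs_covering circle_covering).
    have n11 : \forall s \near fr x, -1 < s < 1.
      have /andP[f0 f1] := fr01 x.
      have f0' : -1 < fr x by lra.
      by apply: filterS2 (lt_nbhsr f0') (lt_nbhsl f1) => s -> ->.
    by apply: filterS2 n1 n11 => s B1s s1; exists s.
  move=> [_ r'] /= [[s [B1s s1] <-] B2r].
  by have := BB (s, r') (conj B1s B2r); rewrite /= /h /= gfr.
- move=> x; rewrite /h /= subr0 scale1r gE ?frE//.
  by have := fr01 x; lra.
- by exists (annulus_cover 0) => x; rewrite /h /= subrr scale0r.
Qed.

End CircleLift.

(** * The lift to the plane of the moved curve, and its degree *)

Section Hopf.
Context {R : realType}.
Local Notation A := (annulus R).
Local Notation vec := (R * R)%type.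
Variables (f : A -> A) (I : R -> A -> A).
Hypothesis isoI : isotopy_from_id f I.
Variable gamma : circle R -> A.
Hypothesis hgamma : C1_essential_curve gamma.
Variable n : nat.

Local Notation loop s := (gamma (circle_cover s)).

Let N : R := n%:R.

Lemma N_ge0 : 0 <= N. Proof. exact: ler0n. Qed.

Definition tangent (z : R * R) : vec :=
  D (flow I n z.1) (loop z.2) (velocity gamma (circle_cover z.2)).

Lemma loop_continuous : continuous (fun s : R => loop s).
Proof.
have [[[_ cg _] _] _ _] := hgamma.
move=> s; apply: (@continuous_comp _ _ _ circle_cover gamma); last exact: cg.
exact: (covering_continuous circle_covering).
Qed.

Lemma moved_loop_continuous :
  continuous (fun z : R * R => flow I n z.1 (loop z.2)).
Proof.
move=> z; apply: (@continuous_comp _ _ _ (fun z : R * R => (z.1, loop z.2))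
  (fun z => flow I n z.1 z.2)); last exact: (flow_continuous isoI).
apply: (@continuous_pair _ _ _ fst (fun z : R * R => loop z.2)).
  exact: continuous_fst.
apply: (@continuous_comp _ _ _ snd (fun s => loop s)); first exact: continuous_snd.
exact: loop_continuous.
Qed.

Lemma tangent_continuous : continuous tangent.
Proof.
have [_ [_ cv] _] := hgamma.
move=> z; apply: (@continuous_comp _ _ _ (fun z : R * R =>
  ((z.1, loop z.2), velocity gamma (circle_cover z.2)))
  (fun z => D (flow I n z.1.1) z.1.2 z.2));
    last exact: (D_flow_continuous isoI).
apply: (@continuous_pair _ _ _ (fun z : R * R => (z.1, loop z.2))
   (fun z : R * R => velocity gamma (circle_cover z.2))).
  apply: (@continuous_pair _ _ _ fst (fun z : R * R => loop z.2)).
    exact: continuous_fst.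
  apply: (@continuous_comp _ _ _ snd (fun s => loop s)); first exact: continuous_snd.
  exact: loop_continuous.
apply: (@continuous_comp _ _ _ (fun z : R * R => circle_cover z.2) (velocity gamma)).
  apply: (@continuous_comp _ _ _ snd circle_cover); first exact: continuous_snd.
  exact: (covering_continuous circle_covering).
exact: (cv 1).
Qed.

(** The parameter is limited to a segment because lifting is done over a compact set; [[-1, 3]]
    contains [[0, 2]], where the ends of the chords lie, in its interior, leaving room for
    derivatives. *)
Lemma curve_lift_exists : exists g : R * R -> vec, continuous g /\
  forall t s : R, -1 <= s <= 3 -> annulus_cover (g (t, s)) = flow I n t (loop s).
Proof.
pose c (z : R * R) := (clamp 0 N z.1, clamp (-1) 3 z.2).
pose h (z : R * R) := flow I n z.1 (loop (clamp (-1) 3 z.2)).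
have cc : continuous c.
  move=> z; apply: (@continuous_pair _ _ _ (fun z : R * R => clamp 0 N z.1)
    (fun z : R * R => clamp (-1) 3 z.2)).
    by apply: (@continuous_comp _ _ _ fst (clamp 0 N));
      [exact: continuous_fst|exact: continuous_clamp].
  by apply: (@continuous_comp _ _ _ snd (clamp (-1) 3));
    [exact: continuous_snd|exact: continuous_clamp].
have ch : continuous h.
  move=> z; apply: (@continuous_comp _ _ _ (fun z : R * R => (z.1, clamp (-1) 3 z.2))
    (fun z => flow I n z.1 (loop z.2))); last exact: moved_loop_continuous.
  apply: (@continuous_pair _ _ _ fst (fun z : R * R => clamp (-1) 3 z.2)).
    exact: continuous_fst.
  by apply: (@continuous_comp _ _ _ snd (clamp (-1) 3));
    [exact: continuous_snd|exact: continuous_clamp].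
have N0 := N_ge0.
have m13 : -1 <= 3 :> R by lra.
have [||||g cg gE] := @exists_circle_lift R (R * R)%type _ c (fun z => (h z).1)
    (@compact_box R 0 N (-1) 3) _ cc.
- move=> [t s] x [] /=; rewrite !in_itv /= => /andP[? ?] /andP[? ?] /andP[? ?].
  by split; rewrite /= ?in_itv /= /GRing.scale /=; apply/andP; split; nra.
- by move=> z; split; rewrite /= in_itv /= clamp_itv.
- by move=> z; rewrite /h /= (flow_clamp isoI) clampK.
- by move=> z; apply: continuous_comp1; exact: ch.
exists (fun z => (g z, (h z).2)); split.
  move=> z; apply: (@continuous_pair _ _ _ g (fun z => (h z).2)); first exact: cg.
  by apply: continuous_comp2; exact: ch.
move=> t s s13; rewrite /annulus_cover gE /h /= clamp_id//.
by rewrite -surjective_pairing.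
Qed.

Variable g : R * R -> vec.
Hypothesis cg : continuous g.
Hypothesis gE : forall t s : R, -1 <= s <= 3 ->
  annulus_cover (g (t, s)) = flow I n t (loop s).

Lemma curve_lift_derive (t s : R) : -1 < s < 3 ->
  is_derive s (1 : R) (fun x => (g (t, x)).1) (tangent (t, s)).1 /\
  is_derive s (1 : R) (fun x => (g (t, x)).2) (tangent (t, s)).2.
Proof.
move=> s13.
have [_ dgam _] := hgamma.
have cC := @circle_covering R; have cA := @annulus_covering R.
have hd := has_differential_comp cA cA
  (differentialP cC cA dgam (circle_cover s)) (flow_diff isoI n t (loop s)).
have cgt : {for s, continuous (fun x => g (t, x))}.
  apply: (@continuous_comp _ _ _ (fun x => (t, x)) g); last exact: cg.
  by apply: continuous_pair; [exact: cvg_cst|exact: cvg_id].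
have near13 : \forall x \near s, annulus_cover (g (t, x)) =
    (flow I n t \o gamma) (circle_cover x).
  have /andP[s1 s3] := s13.
  apply: filterS2 (lt_nbhsr s1) (lt_nbhsl s3) => x x1 x3.
  by rewrite gE// !ltW.
have df := has_differential_lift cC cA hd cgt near13.
by split; [exact: (is_derive_fst df)|exact: (is_derive_snd df)].
Qed.

Lemma circle_coverD1 (s : R) : circle_cover (s + 1) = circle_cover s.
Proof. by apply/circle_coverP; rewrite addrAC subrr add0r rpred1. Qed.

(** The horizontal displacement over one period is an integer, constant along the segment from
    [(0, 0)] to [(t, s)]; [d] is the degree of the curve around the annulus. *)
Lemma curve_lift_degree : exists d : int, forall t s : R, -1 <= s <= 2 ->
  g (t, s + 1) = g (t, s) + (d%:~R, 0).
Proof.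
pose del (z : R * R) := (g (z.1, z.2 + 1)).1 - (g z).1.
have gdel t s : -1 <= s <= 2 ->
    del (t, s) \is a Num.int /\ (g (t, s + 1)).2 = (g (t, s)).2.
  move=> s12; apply/and_comm.
  have : annulus_cover (g (t, s + 1)) = annulus_cover (g (t, s)).
    by rewrite !gE ?circle_coverD1//; lra.
  by move=> /annulus_cover_eq[/circle_coverP h ->].
have [d d0] : exists d : int, del (0, 0) = d%:~R.
  by apply/intrP; apply: (gdel _ _ _).1; lra.
exists d => t s s12; have [_ e2] := gdel t s s12.
suff e1 : del (t, s) = d%:~R.
  rewrite [LHS]surjective_pairing e2 [g (t, s)]surjective_pairing.
  by congr (_, _); rewrite /= ?addr0// -e1 /del/= [RHS]addrC subrK.
rewrite -d0; have := @int_valued_const _ (fun x => del (x * t, x * s)) 0 1.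
rewrite !mul0r !mul1r => -> //.
- have cx : continuous (fun x : R => (x * t, x * s)).
    move=> x; apply: (@continuous_pair R R R (fun x : R => x * t) (fun x : R => x * s));
      by apply: cvgMl; exact: cvg_id.
  apply: continuous_subspaceT => x.
  apply: (@continuous_comp _ _ _ (fun x : R => (x * t, x * s)) del); first exact: cx.
  apply: cvgB; apply: continuous_comp1; last exact: cg.
  apply: (@continuous_comp _ _ _ (fun z : R * R => (z.1, z.2 + 1)) g);
    last exact: cg.
  apply: (@continuous_pair _ _ _ fst (fun z : R * R => z.2 + 1)).
    exact: continuous_fst.
  by apply: cvgD; [exact: continuous_snd|exact: cvg_cst].
- by move=> x /andP[x0 x1]; apply: (gdel _ _ _).1; apply/andP; split; nra.
Qed.

(** For [d = 0] the lift at time 0, where the flow is the identity, would close up and [gamma] would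
    be null homotopic. *)
Lemma curve_lift_degree_neq0 (d : int) :
  (forall t s : R, -1 <= s <= 2 -> g (t, s + 1) = g (t, s) + (d%:~R, 0)) -> d != 0.
Proof.
move=> gd; apply/eqP => d0; have [[_ +] _ _] := hgamma; apply.
apply: (@null_homotopic_lift _ _ (fun s => g (0, s))).
- move=> s; apply: (@continuous_comp _ _ _ (fun x => (0, x)) g); last exact: cg.
  by apply: continuous_pair; [exact: cvg_cst|exact: cvg_id].
- by move=> s s13; rewrite gE// (flow_le0 isoI).
- by move=> s s12; rewrite gd// d0 addr0.
Qed.

Lemma curve_lift_inj (t s h : R) : -1 <= s -> s + h <= 3 -> 0 < h < 1 ->
  g (t, s + h) != g (t, s).
Proof.
move=> s1 sh /andP[h0 h1]; apply/eqP => e.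
have [[[gi _ _] _] _ _] := hgamma.
have : flow I n t (loop (s + h)) = flow I n t (loop s).
  by rewrite -!gE ?e//; lra.
move=> /(flow_injective isoI)/gi/circle_coverP.
rewrite addrAC subrr add0r => /intrP[m hm].
have : 0%:~R < m%:~R :> R by rewrite -hm.
have : m%:~R < 1%:~R :> R by rewrite -hm.
by rewrite !ltr_int; lia.
Qed.

End Hopf.

(** * Continuous angles of chords and tangents *)

Section SecantLift.
Context {R : realType}.
Local Notation A := (annulus R).
Local Notation vec := (R * R)%type.
Variables (f : A -> A) (I : R -> A -> A).
Hypothesis isoI : isotopy_from_id f I.
Variable gamma : circle R -> A.
Hypothesis hgamma : C1_essential_curve gamma.

Lemma tangent_neq0 n z : tangent I gamma n z != 0.
Proof. by have [_ _ v0] := hgamma; apply: (D_flow_neq0 isoI); exact: v0. Qed.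

Lemma has_angle_int_up (k : int) (w : vec) : has_angle k%:~R w -> 0 < w.2.
Proof.
move=> [r r0 ->]; have := turnD_int (0 : R) k; rewrite add0r => ->.
by rewrite turn0 /= /GRing.scale /= mulr1.
Qed.

Variable n : nat.
Let N : R := n%:R.
Variable g : R * R -> vec.
Hypothesis cg : continuous g.
Hypothesis gE : forall t s : R, -1 <= s <= 3 ->
  annulus_cover (g (t, s)) = flow I n t (gamma (circle_cover s)).

(** Clamping makes [chord] continuous and non-vanishing on the whole space, as [exists_angle]
    requires, while [g] is controlled only for parameters in [[-1, 3]]. *)
Definition secant_box (z : R * (R * R)) : R * (R * R) :=
  (1 - clamp 0 1 z.1, (clamp 0 N z.2.1, clamp 0 1 z.2.2)).

(* At [z = (u, (t, s))], the chord from [s] to [s + (1 - u)] of the lift of the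
   curve at time [t]: the tangent vector for [u = 1], and for [u = 0] the
   displacement [(d, 0)] along the whole curve. *)
Definition chord (z : R * (R * R)) : vec :=
  (secant (fun p => (g p).1) (fun p => (tangent I gamma n p).1) (secant_box z),
   secant (fun p => (g p).2) (fun p => (tangent I gamma n p).2) (secant_box z)).

Lemma secant_box_continuous : continuous secant_box.
Proof.
move=> z; apply: (@continuous_pair _ _ _ (fun z : R * (R * R) => 1 - clamp 0 1 z.1)
  (fun z : R * (R * R) => (clamp 0 N z.2.1, clamp 0 1 z.2.2))).
  apply: cvgB; first exact: cvg_cst.
  apply: (@continuous_comp _ _ _ fst (clamp 0 1)); first exact: continuous_fst.
  exact: continuous_clamp.
apply: (@continuous_pair _ _ _ (fun z : R * (R * R) => clamp 0 N z.2.1)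
  (fun z : R * (R * R) => clamp 0 1 z.2.2)).
  apply: (@continuous_comp _ _ _ (fun z : R * (R * R) => z.2.1) (clamp 0 N)).
    by apply: continuous_comp1; exact: continuous_snd.
  exact: continuous_clamp.
apply: (@continuous_comp _ _ _ (fun z : R * (R * R) => z.2.2) (clamp 0 1)).
  by apply: continuous_comp2; exact: continuous_snd.
exact: continuous_clamp.
Qed.

Lemma secant_box1 z : 0 <= (secant_box z).1 <= 1.
Proof. by have := @clamp_itv R 0 1 z.1 ler01; rewrite /secant_box /=; lra. Qed.

Lemma secant_box22 z : 0 <= (secant_box z).2.2 <= 1.
Proof. exact: clamp_itv ler01. Qed.

Lemma chord_continuous : continuous chord.
Proof.
have ct := @tangent_continuous R f I isoI gamma hgamma n.
have dgt := curve_lift_derive isoI hgamma cg gE.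
move=> z; apply: (@continuous_pair _ _ _
  (secant (fun p => (g p).1) (fun p => (tangent I gamma n p).1) \o secant_box)
  (secant (fun p => (g p).2) (fun p => (tangent I gamma n p).2) \o secant_box)).
  apply: secant_continuous.
  - by move=> p; apply: continuous_comp1; exact: cg.
  - by move=> p; apply: continuous_comp1; exact: ct.
  - by move=> t s s13; have [] := dgt t s s13.
  - exact: secant_box1.
  - exact: secant_box22.
  - exact: secant_box_continuous.
apply: secant_continuous.
- by move=> p; apply: continuous_comp2; exact: cg.
- by move=> p; apply: continuous_comp2; exact: ct.
- by move=> t s s13; have [] := dgt t s s13.
- exact: secant_box1.
- exact: secant_box22.
- exact: secant_box_continuous.
Qed.

Lemma chord_scale z : (secant_box z).1 != 0 ->
  chord z = (secant_box z).1^-1 *: (g ((secant_box z).2.1,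
    (secant_box z).2.2 + (secant_box z).1) - g (secant_box z).2).
Proof.
move=> h0; rewrite /chord /secant (negbTE h0) /=.
rewrite [RHS]surjective_pairing /= /GRing.scale /=.
by rewrite [in RHS]mulrC [X in _ = (_, X)]mulrC.
Qed.

Lemma chord_tangent t s : 0 <= t <= N -> 0 <= s <= 1 ->
  chord (1, (t, s)) = tangent I gamma n (t, s).
Proof.
move=> tN s01; rewrite /chord /secant_box /= !clamp_id ?lexx ?ler01//.
by rewrite subrr /secant /= eqxx -surjective_pairing.
Qed.

Variable d : int.
Hypothesis gd : forall t s : R, -1 <= s <= 2 -> g (t, s + 1) = g (t, s) + (d%:~R, 0).

Lemma chord_start t s : chord (0, (t, s)) = (d%:~R, 0).
Proof.
have b1 : (secant_box (0, (t, s))).1 = 1.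
  by rewrite /secant_box /= clamp_id ?lexx ?ler01// subr0.
rewrite chord_scale b1 ?oner_neq0// invr1 scale1r gd.
  by rewrite -surjective_pairing addrAC subrr add0r.
by have := secant_box22 (0, (t, s)); lra.
Qed.

(** At step 0 the tangent is non-zero, at step 1 the degree is, and in between the moved curve is
    injective. *)
Lemma chord_neq0 z : chord z != 0.
Proof.
have [h0|hn] := eqVneq (secant_box z).1 0.
  rewrite /chord /secant h0 eqxx -surjective_pairing; exact: tangent_neq0.
have b1 := secant_box1 z; have b2 := secant_box22 z.
rewrite chord_scale// scaler_eq0 invr_eq0 (negbTE hn) orFb subr_eq0.
have [h1|h1] := eqVneq (secant_box z).1 1.
  rewrite h1 gd; last lra.
  rewrite -surjective_pairing eq_sym -subr_eq0 opprD addrA subrr add0r oppr_eq0.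
  have d0 := curve_lift_degree_neq0 isoI hgamma cg gE gd.
  by apply/eqP => -[/eqP]; rewrite intr_eq0 (negbTE d0).
rewrite [X in _ == g X]surjective_pairing.
apply: (curve_lift_inj isoI hgamma gE); [lra|lra|].
by rewrite lt_neqAle [0 == _]eq_sym hn lt_neqAle h1 !andTb.
Qed.

Lemma chord_angle : exists2 a : R * (R * R) -> R, continuous a &
  forall z, has_angle (a z) (chord z).
Proof.
pose c (z : R * (R * R)) := (clamp 0 1 z.1, (clamp 0 N z.2.1, clamp 0 1 z.2.2)).
have N0 : 0 <= N by exact: ler0n.
apply: (@exists_angle R (R * (R * R))%type (`[0, 1] `*` (`[0, N] `*` `[0, 1])) c).
- by apply: compact_setX; [exact: segment_compact|exact: compact_box].
- move=> [u [t s]] x [] /=; rewrite !in_itv /= => /andP[? ?] [].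
  rewrite ?in_itv /= => /andP[? ?] /andP[? ?] /andP[? ?].
  split; last split; rewrite /= ?in_itv /= /GRing.scale /=; apply/andP; split; nra.
- move=> z; apply: (@continuous_pair _ _ _ (fun z : R * (R * R) => clamp 0 1 z.1)
    (fun z : R * (R * R) => (clamp 0 N z.2.1, clamp 0 1 z.2.2))).
    apply: (@continuous_comp _ _ _ fst (clamp 0 1)); first exact: continuous_fst.
    exact: continuous_clamp.
  exact: continuous_comp2 (@secant_box_continuous z).
- by move=> z; split; last split; rewrite /= ?in_itv /= clamp_itv// ler01.
- by move=> z; rewrite /chord /secant_box /c /= !clampK ?ler01.
- exact: chord_continuous.
- exact: chord_neq0.
Qed.

(** The chord over a full period is always [(d, 0)], so its angle varies by integers only, hence not
    at all. *)
Lemma chord_angle_start (a : R * (R * R) -> R) : continuous a ->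
  (forall z, has_angle (a z) (chord z)) ->
  forall t s, a (0, (t, s)) = a (0, (0, 0)).
Proof.
move=> ca ha t s.
have := @int_valued_const _ (fun x => a (0, (x * t, x * s)) - a (0, (0, 0))) 0 1.
rewrite !mul0r !mul1r subrr => h; apply/eqP; rewrite -subr_eq0; apply/eqP.
apply/esym/h; first exact: ler01.
- apply: continuous_subspaceT => x; apply: cvgB; last exact: cvg_cst.
  apply: (@continuous_comp R (R * (R * R))%type R (fun x : R => (0, (x * t, x * s))) a);
    last exact: ca.
  apply: (@continuous_pair R R (R * R)%type (fun=> 0) (fun x : R => (x * t, x * s))).
    exact: cvg_cst.
  apply: (@continuous_pair R R R (fun x : R => x * t) (fun x : R => x * s));
    by apply: cvgMl; exact: cvg_id.
- move=> x _; apply: (@has_angle_eq _ _ _ (d%:~R, 0)).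
    by rewrite -(chord_start (x * t) (x * s)).
  by rewrite -(chord_start 0 0).
Qed.

(* All chords issued from a highest point of the curve point downwards, so that
   their angle cannot cross a multiple of a full turn. *)
Lemma chord_angle_top (a : R * (R * R) -> R) t : continuous a ->
  (forall z, has_angle (a z) (chord z)) ->
  0 <= a (0, (0, 0)) < 1 -> 0 <= t <= N ->
  exists2 s, 0 <= s <= 1 & -1 <= a (1, (t, s)) <= 1.
Proof.
move=> ca ha a0 tN.
have cgt : continuous (fun x : R => (g (t, x)).2).
  move=> x; apply: continuous_comp2.
  apply: (@continuous_comp _ _ _ (fun x : R => (t, x)) g); last exact: cg.
  by apply: continuous_pair; [exact: cvg_cst|exact: cvg_id].
have [s sI smax] := @EVT_max R (fun x : R => (g (t, x)).2) 0 1 ler01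
  (continuous_subspaceT cgt).
have s01 : 0 <= s <= 1 by move: sI; rewrite in_itv.
(* A maximum over one period is also one over [[0, 2]], which contains the far ends of all chords
   from [s]. *)
have top x : 0 <= x <= 2 -> (g (t, x)).2 <= (g (t, s)).2.
  move=> /andP[x0 x2]; have [x1|x1] := leP x 1.
    by apply: smax; rewrite in_itv /= x0 x1.
  rewrite -(subrK 1 x) gd; last lra.
  by rewrite /= addr0; apply: smax; rewrite in_itv /=; lra.
have down u : 0 <= u < 1 -> (chord (u, (t, s))).2 <= 0.
  move=> u01; have b : secant_box (u, (t, s)) = (1 - u, (t, s)).
    by rewrite /secant_box /= !clamp_id//; lra.
  rewrite chord_scale b /=; last by lra.
  rewrite /GRing.scale /= pmulr_rle0 ?invr_gt0; last lra.
  by rewrite subr_le0; apply: top; lra.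
have start := chord_angle_start ca ha t s.
have cu : continuous (fun u : R => a (u, (t, s))).
  move=> u; apply: (@continuous_comp R (R * (R * R))%type R (fun u : R => (u, (t, s))) a);
    last exact: ca.
  by apply: continuous_pair; [exact: cvg_id|exact: cvg_cst].
(* An integer angle points straight up, which [down] forbids for [u < 1]; the assumption on
   [a (1, (t, s))] deals with [u = 1]. It holds below for [k = -1] and [k = 1], the angle being
   supposed to end beyond these values. *)
have nocross (k : int) u : 0 <= u <= 1 -> a (1, (t, s)) != k%:~R ->
    a (u, (t, s)) != k%:~R.
  move=> /andP[u0 u1] a1; apply/eqP => au.
  have u1' : u < 1.
    rewrite lt_neqAle u1 andbT; apply: contra a1 => /eqP ue.
    by move: au; rewrite ue => ->.
  have : 0 < (chord (u, (t, s))).2.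
    by apply: (@has_angle_int_up k); rewrite -au.
  by rewrite ltNge down// u0.
exists s => //; apply/andP; split; rewrite leNgt; apply/negP => lt.
- have [|u uI au] := @IVT R (fun u : R => a (u, (t, s))) 0 1 (-1) ler01
    (continuous_subspaceT cu).
    have le01 : a (1, (t, s)) <= a (0, (t, s)) by rewrite start; lra.
    by rewrite (min_r le01) (max_l le01) start; lra.
  have := @nocross (-1) u; rewrite au eqxx.
  by move: uI; rewrite in_itv /= => -> /(_ isT); rewrite lt_eqF// => /(_ isT).
- have [|u uI au] := @IVT R (fun u : R => a (u, (t, s))) 0 1 1 ler01
    (continuous_subspaceT cu).
    have le01 : a (0, (t, s)) <= a (1, (t, s)) by rewrite start; lra.
    by rewrite (min_l le01) (max_r le01) start; lra.
  have := @nocross 1 u; rewrite au eqxx.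
  by move: uI; rewrite in_itv /= => -> /(_ isT); rewrite gt_eqF// => /(_ isT).
Qed.

End SecantLift.

(** * Points of bounded rotation *)

Section Conclusion.
Context {R : realType}.
Local Notation A := (annulus R).
Local Notation vec := (R * R)%type.
Variables (f : A -> A) (I : R -> A -> A).
Hypothesis isoI : isotopy_from_id f I.
Variable gamma : circle R -> A.
Hypothesis hgamma : C1_essential_curve gamma.

Local Notation loop s := (gamma (circle_cover s)).
Local Notation speed s := (velocity gamma (circle_cover s)).
Local Notation rot m s := (rotation I m (loop s) (speed s)).

(** The angle of the full-period chord is the same for all [t] and [s], so a single integer shift
    brings it into [[0, 1[], and [chord_angle_top] then applies at every time. *)
Lemma tangent_angle n : exists2 a : R * R -> R, continuous a &
  (forall t s, 0 <= t <= n%:R -> 0 <= s <= 1 ->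
    has_angle (a (t, s)) (tangent I gamma n (t, s))) /\
  (forall t, 0 <= t <= n%:R -> exists2 s, 0 <= s <= 1 & -1 <= a (t, s) <= 1).
Proof.
have [g [cg gE]] := curve_lift_exists isoI hgamma n.
have [d gd] := curve_lift_degree cg gE.
have [b cb hb] := chord_angle isoI hgamma cg gE gd.
pose k := Num.floor (b (0, (0, 0))).
pose b' z := b z - k%:~R.
have cb' : continuous b'.
  by move=> z; apply: cvgB; [exact: cb|exact: cvg_cst].
have hb' z : has_angle (b' z) (chord I gamma n g z).
  apply: has_angle_shift (hb z).
  by rewrite /b' opprB addrC subrK intr_int.
have b0 : 0 <= b' (0, (0, 0)) < 1.
  by rewrite subr_ge0 ltrBlDl floor_le//= -[1]/(1%:~R) -intrD floorD1_gt.
exists (fun p => b' (1, p)); last split.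
- move=> p; apply: (@continuous_comp _ _ _ (fun p : R * R => (1 : R, p)) b');
  last exact: cb'.
  by apply: continuous_pair; [exact: cvg_cst|exact: cvg_id].
- move=> t s tn s01; rewrite -(chord_tangent I gamma g tn s01); exact: hb'.
- move=> t tn; exact: (chord_angle_top cg gd cb' hb' b0 tn).
Qed.

Lemma speed_neq0 (s : R) : speed s != 0.
Proof. by have [_ _] := hgamma. Qed.

Lemma tangent_extend n t s : 0 <= t <= n%:R ->
  tangent I gamma n (t, s) = D (extend_isotopy I t) (loop s) (speed s).
Proof. by move=> tn; rewrite /tangent (flow_extend isoI tn). Qed.

Lemma rotation_tangent n (a : R * R -> R) m (s : R) : continuous a ->
  (forall t s, 0 <= t <= n%:R -> 0 <= s <= 1 ->
    has_angle (a (t, s)) (tangent I gamma n (t, s))) ->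
  (m <= n)%N -> 0 <= s <= 1 -> rot m s = a (m%:R, s) - a (0, s).
Proof.
move=> ca ha mn s01; have [_ hv] := vtildeP isoI (loop s) (speed_neq0 s).
apply: (@angle_variation_uniq _ _ (fun t => a (t, s))
  (fun t => D (extend_isotopy I t) (loop s) (speed s))).
- by [].
- by apply: (vtilde_within isoI) => //; exact: speed_neq0.
- apply: continuous_subspaceT => t.
  apply: (@continuous_comp _ _ _ (fun t : R => (t, s)) a); last exact: ca.
  by apply: continuous_pair; [exact: cvg_id|exact: cvg_cst].
- by move=> t /andP[t0 _]; exact: hv.
- move=> t /andP[t0 tm].
  have tn : 0 <= t <= n%:R by rewrite t0 (le_trans tm)// ler_nat.
  by rewrite -(tangent_extend _ tn); exact: ha.
Qed.

Lemma tangent0 n m (s : R) : tangent I gamma n (0, s) = tangent I gamma m (0, s).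
Proof. by rewrite /tangent /= !(flow_le0 isoI). Qed.

Hypothesis neg : forall z, vtilde I z chi 1 < vtilde I z chi 0.

(** The parameter [s] comes from a highest point at time [n], where the angle is at least -1. An
    earlier angle at most [- (3 / 2)] would stay so until time [n]. The initial angle at [s] is
    bounded above independently of [n]. *)
Lemma slow_rotation : exists C : R, forall n, exists2 s, 0 <= s <= 1 &
  forall m, (m <= n)%N -> - C <= rot m s.
Proof.
have [b cb [hb _]] := tangent_angle 0.
have cb0 : continuous (fun s : R => b (0, s)).
  move=> s; apply: (@continuous_comp _ _ _ (fun s : R => (0 : R, s)) b);
    last exact: cb.
  by apply: continuous_pair; [exact: cvg_cst|exact: cvg_id].
have [x xI xmax] := @EVT_max R _ 0 1 ler01 (continuous_subspaceT cb0).
have [y yI ymin] := @EVT_min R _ 0 1 ler01 (continuous_subspaceT cb0).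
(* The level [- (3 / 2)] is a multiple of a half turn below -1. The rest bounds [a (0, s)]: at most
   1 at some parameter [s0], plus the oscillation of the initial angle. *)
exists (3 / 2 + (1 + (b (0, x) - b (0, y)))) => n.
have [a ca [ha atop]] := tangent_angle n.
have nn : 0 <= (n%:R : R) <= n%:R by rewrite ler0n lexx.
have n0 : 0 <= (0 : R) <= n%:R by rewrite lexx ler0n.
have [s s01 an] := atop _ nn.
have [s0 s001 a0] := atop _ n0.
(* At time 0 the tangent does not depend on [n], so [a] oscillates there as [b] does. *)
have ab u v : 0 <= u -> u <= v -> v <= 1 ->
    a (0, v) - a (0, u) = b (0, v) - b (0, u).
  move=> u0 uv v1.
  apply: (@angle_variation_uniq _ (fun s => a (0, s)) (fun s => b (0, s))
    (fun s => tangent I gamma n (0, s))) => //.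
  - apply: continuous_subspaceT => z.
    apply: (@continuous_comp _ _ _ (fun s : R => (0 : R, s)) a); last exact: ca.
    by apply: continuous_pair; [exact: cvg_cst|exact: cvg_id].
  - exact: continuous_subspaceT.
  - by move=> z /andP[uz zv]; apply: ha => //; rewrite (le_trans u0)// (le_trans zv).
  - move=> z /andP[uz zv]; rewrite (tangent0 n 0); apply: hb.
      by rewrite lexx.
    by rewrite (le_trans u0)// (le_trans zv).
have as0 : a (0, s) <= 1 + (b (0, x) - b (0, y)).
  have xs := xmax s; have xs0 := xmax s0; have ys := ymin s; have ys0 := ymin s0.
  rewrite !in_itv /= in xs xs0 ys ys0.
  move: (xs s01) (xs0 s001) (ys s01) (ys0 s001) => {}xs {}xs0 {}ys {}ys0.
  by have [ss|ss] := leP s s0; [have := ab s s0|have := ab s0 s]; lra.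
exists s => // m mn.
rewrite (rotation_tangent ca ha)//.
suff : - (3 / 2) < a (m%:R, s) by lra.
rewrite ltNge; apply/negP => am.
have [_ hv] := vtildeP isoI (loop s) (speed_neq0 s).
have /intrP[j jE] : vtilde I (loop s) (speed s) 0 - a (0, s) \is a Num.int.
  apply: has_angle_eq (hv 0 (lexx 0)) _.
  by rewrite -(@tangent_extend n)//; exact: ha.
have rm := rotation_tangent ca ha mn s01.
have rn := rotation_tangent ca ha (leqnn n) s01.
rewrite /rotation in rm rn.
(* Since [vtilde] exceeds [a] by the integer [j], the level [- (3 / 2)] for [a] becomes
   [(2 * j - 3) / 2]. *)
have := @vtilde_mono _ _ _ isoI neg m n (loop s) _ (2 * j - 3) (speed_neq0 s) mn.
by rewrite intrB intrM => h; have := h _; lra.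
Qed.

(** At a cluster point of the parameters of [slow_rotation] every lower bound survives, each being a
    closed condition that holds from rank [m] on. *)
Lemma bounded_rotation : exists2 s : R, 0 <= s <= 1 &
  exists C : R, forall m, `|rot m s| <= C.
Proof.
have [C HC] := slow_rotation.
have [u uP] : {u : nat -> R & forall n, 0 <= u n <= 1 /\
    forall m, (m <= n)%N -> - C <= rot m (u n)}.
  apply: (@choice _ _ (fun n s => 0 <= s <= 1 /\
    forall m, (m <= n)%N -> - C <= rot m s)) => n.
  by have [s s01 hs] := HC n; exists s.
have [s [s01 hs]] : `[0, 1] `&` cluster (u @ \oo) !=set0.
  apply: segment_compact; exists 0%N => // n _ /=; rewrite in_itv /=.
  by have [] := uP n.
rewrite /= in_itv /= in s01.
exists s => //; have low m : - C <= rot m s.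
  (* The lifts [vtilde] are chosen point by point; continuity in the parameter comes from the joint
     angle [a]. *)
  have [a ca [ha _]] := tangent_angle m.
  pose F : set R := `[0, 1] `&` [set x | - C <= a (m%:R, x) - a (0, x)].
  have cF : closed F.
    apply: closedI; first exact: itv_closed.
    have cx (t : R) : continuous (fun x : R => a (t, x)).
      move=> x; apply: (@continuous_comp _ _ _ (fun x : R => (t, x)) a);
        last exact: ca.
      by apply: continuous_pair; [exact: cvg_cst|exact: cvg_id].
    apply: (@closed_comp _ _ (fun x => a (m%:R, x) - a (0, x)) [set y | - C <= y]).
      by move=> x _; apply: cvgB; exact: cx.
    exact: closed_ge.
  have uF : (u @ \oo) F.
    exists m => // n /= mn; have [u01 un] := uP n.
    split; rewrite /= ?in_itv//=.
    by rewrite -(rotation_tangent ca ha (leqnn m))//; exact: un.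
  have : closure F s.
    by move: hs; rewrite clusterE => /(_ F uF).
  rewrite -(closure_id F).1// => -[_ /=].
  by rewrite -(rotation_tangent ca ha (leqnn m)).
pose v := vtilde I (loop s) (speed s).
(* The first multiple of a half turn above [v 0] is a barrier at all later times, so the rotation
   stays below a half turn. *)
pose k := Num.ceil (2 * v 0).
have k2 : (k%:~R : R) < 2 * v 0 + 1.
  by rewrite -ltrBlDr -[1]/(1%:~R) -intrB gt_pred_ceil.
have vk : v 0 <= k%:~R / 2 by rewrite ler_pdivlMr// mulrC ceil_ge.
exists (`|C| + 1) => m; rewrite ler_norml; apply/andP; split.
  have := low m; have := ler_norm C; lra.
have := @vtilde_mono _ _ _ isoI neg 0 m (loop s) _ k (speed_neq0 s) (leq0n _) vk.
rewrite /rotation -/v; have := normr_ge0 C; lra.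
Qed.

End Conclusion.

Theorem theorem1p1 (R : realType) (f : annulus R -> annulus R)
    (hf : negative_torsion_map f)
    (gamma : circle R -> annulus R) (hgamma : C1_essential_curve gamma) :
  exists2 z : annulus R, range gamma z & has_torsion f z 0.
Proof.
have [_ [J hJ] neg] := hf; pose I := chosen_isotopy f.
have isoI : isotopy_from_id f I by apply: getI; exact: hJ.
have neg' z : vtilde I z chi 1 < vtilde I z chi 0.
  by have := neg z; rewrite /torsion_n -/I /= divr1 subr_lt0.
have [s _ [C HC]] := bounded_rotation isoI hgamma neg'.
exists (gamma (circle_cover s)); first by exists (circle_cover s).
move=> xi xi0; set z := gamma _ in HC *.
(* Every vector at [z] has bounded rotation, so its quotient by [n] tends to 0. *)
have rxi n : `|rotation I n z xi| <= C + 1.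
  have v0 := speed_neq0 hgamma s.
  have h1 := rotation_cmp isoI n z xi0 v0.
  have h2 := rotation_cmp isoI n z v0 xi0.
  have := HC n; rewrite !ler_norml; lra.
have -> : (fun n => torsion_n n f z xi) = (fun n => rotation I n z xi / n%:R) by [].
apply/cvgrPdist_lt => e e0; near=> n.
rewrite sub0r normrN normrM normfV.
have n0 : 0 < n%:R :> R by rewrite ltr0n; near: n; exact: nbhs_infty_gt.
rewrite [`|n%:R|]gtr0_norm// ltr_pdivrMr//.
apply: le_lt_trans (rxi n) _; rewrite mulrC -ltr_pdivrMr//.
by near: n; exact: nbhs_infty_gtr.
Unshelve. all: end_near.
Qed.
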